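(* Let $X$ be the class of $S_{1,2,3}$-free bipartite graphs. Then $R^b_X(p,q)\le 6(p+q)$ for all positive integers $p,q$.
   Context: All graphs are finite and simple. $S_{1,2,3}$ is the tree obtained from the claw $K_{1,3}$ by subdividing one of its edges once and another of its edges twice (so it has 7 vertices). A graph is $H$-free if it contains no induced subgraph isomorphic to $H$. A bipartite graph $G=(A,B,E)$ is given together with a bipartition $A\cup B$ of its vertex set into two independent sets (its parts). The bipartite complement $\widetilde{G}$ of $G$ is the bipartite graph on the same vertex set and with the same parts in which $a\in A$ and $b\in B$ are adjacent if and only if they are not adjacent in $G$. $K_{n,n}$ is the complete bipartite graph with $n$ vertices in each part. For a class $X$ of bipartite graphs, $R^b_X(p,q)$ is the minimum $n$ such that every $G\in X$ with at least $n$ vertices in each of the parts satisfies: $G$ contains $K_{p,p}$ as an induced subgraph or $\widetilde{G}$ contains $K_{q,q}$ as an induced subgraph. *)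

(* Defs.v *)
From mathcomp Require Import all_boot.

Set Implicit Arguments.
Unset Strict Implicit.
Unset Printing Implicit Defensive.

Record sgraph := SGraph {
  vertex :> finType;
  adj : rel vertex;
  adj_sym : symmetric adj;
  adj_irrefl : irreflexive adj }.

Arguments adj {s} _ _.

Section Induced.
Variables (G : sgraph) (S : {set G}).

Definition induced_adj : rel {x : G | x \in S} := fun x y => adj (val x) (val y).

Lemma induced_adj_sym : symmetric induced_adj.
Proof. by move=> x y; apply: adj_sym. Qed.

Lemma induced_adj_irrefl : irreflexive induced_adj.
Proof. by move=> x; apply: adj_irrefl. Qed.

Definition induced : sgraph := SGraph induced_adj_sym induced_adj_irrefl.
End Induced.

Definition isomorphic (G H : sgraph) : Prop :=
  exists f : G -> H, bijective f /\ forall x y, adj (f x) (f y) = adj x y.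

Definition contains_induced (H G : sgraph) : Prop :=
  exists S : {set G}, isomorphic H (induced S).

Definition free (H G : sgraph) : Prop := ~ contains_induced H G.

(* The centre of the claw is 0; the three legs are 0-1, 0-2-3 and 0-4-5-6. *)
Definition S123_edges : seq (nat * nat) :=
  [:: (0, 1); (0, 2); (2, 3); (0, 4); (4, 5); (5, 6)].

Definition S123_adj : rel 'I_7 := fun i j =>
  ((val i, val j) \in S123_edges) || ((val j, val i) \in S123_edges).

Lemma S123_adj_sym : symmetric S123_adj.
Proof. by move=> i j; rewrite /S123_adj orbC. Qed.

Lemma S123_adj_irrefl : irreflexive S123_adj.
Proof. by case; do 7! case=> //. Qed.

Definition S123 : sgraph := SGraph S123_adj_sym S123_adj_irrefl.

Section CompleteBipartite.
Variable n : nat.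

Definition Knn_adj : rel ('I_n + 'I_n) := fun x y =>
  match x, y with
  | inl _, inr _ | inr _, inl _ => true
  | _, _ => false
  end.

Lemma Knn_adj_sym : symmetric Knn_adj.
Proof. by case=> i [] j. Qed.

Lemma Knn_adj_irrefl : irreflexive Knn_adj.
Proof. by case. Qed.

Definition Knn : sgraph := SGraph Knn_adj_sym Knn_adj_irrefl.
End CompleteBipartite.

Definition independent (G : sgraph) (S : {set G}) : Prop :=
  forall x y, x \in S -> y \in S -> ~~ adj x y.

(* The bipartition is part of the data; a part may be empty. *)
Record bigraph := BiGraph {
  bigraph_graph :> sgraph;
  partA : {set bigraph_graph};
  partB : {set bigraph_graph};
  parts_cover : partA :|: partB = [set: bigraph_graph];
  parts_disjoint : [disjoint partA & partB];
  partA_indep : independent partA;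
  partB_indep : independent partB }.

Section BipartiteComplement.
Variable G : bigraph.

Definition bcompl_adj : rel G := fun x y =>
  ((x \in partA G) && (y \in partB G) || (x \in partB G) && (y \in partA G))
  && ~~ adj x y.

Lemma bcompl_adj_sym : symmetric bcompl_adj.
Proof.
move=> x y; rewrite /bcompl_adj adj_sym orbC.
by rewrite [(x \in partB G) && _]andbC [(x \in partA G) && _]andbC.
Qed.

Lemma bcompl_adj_irrefl : irreflexive bcompl_adj.
Proof.
move=> x; rewrite /bcompl_adj [(x \in partB G) && _]andbC orbb.
case: (boolP (x \in partA G)) => // xA.
by rewrite (disjointFr (parts_disjoint G) xA).
Qed.

Definition bcompl_graph : sgraph := SGraph bcompl_adj_sym bcompl_adj_irrefl.

Lemma bcompl_partA_indep : @independent bcompl_graph (partA G).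
Proof.
move=> x y xA yA; rewrite /adj /= /bcompl_adj.
by rewrite !(disjointFr (parts_disjoint G)) // !andbF.
Qed.

Lemma bcompl_partB_indep : @independent bcompl_graph (partB G).
Proof.
move=> x y xB yB; rewrite /adj /= /bcompl_adj.
by rewrite !(disjointFl (parts_disjoint G)) // !andbF.
Qed.

Definition bcompl : bigraph :=
  @BiGraph bcompl_graph (partA G) (partB G) (parts_cover G) (parts_disjoint G)
    bcompl_partA_indep bcompl_partB_indep.
End BipartiteComplement.

Definition bramsey_property (X : bigraph -> Prop) (p q n : nat) : Prop :=
  forall G : bigraph, X G -> n <= #|partA G| -> n <= #|partB G| ->
    contains_induced (Knn p) G \/ contains_induced (Knn q) (bcompl G).

(* [n] is the bipartite Ramsey number R^b_X(p, q); the number is given as a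
   relation, so the existence of the minimum has to be proved along with any
   bound on it. *)
Definition is_bramsey (X : bigraph -> Prop) (p q n : nat) : Prop :=
  bramsey_property X p q n /\ forall m, bramsey_property X p q m -> n <= m.

Definition S123_free (G : bigraph) : Prop := free S123 G.

(* Main.v *)
Require Import Defs.
From Stdlib Require Import Classical_Prop.
From mathcomp Require Import all_boot.
From mathcomp Require Import zify.

(* Write the bigraph as a relation e between its parts. Say that (X, Y) is
   homogeneous if no vertex outside it distinguishes two opposite vertices of
   it. If G has neither biclique, a homogeneous pair with both sides at least
   p + q misses fewer than p + q vertices on each side; take a minimal one. It
   is indecomposable: for no proper nontrivial (X, Y) are both "X versus the
   complement of Y" and "the complement of X versus Y" constant.

   In an indecomposable S_{1,2,3}-free bigraph:
   - a homogeneous pair in which some vertex of each part is mixed is the whole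
     bigraph;
   - there is an induced P7 (from a maximal induced subgraph having two
     components with edges);
   - take F = P8 or C8 if induced in e, or P8 if it is induced in the bipartite
     complement, and F = P7 otherwise. The copies of F reachable from one of them
     by exchanging one vertex at a time span a homogeneous pair, hence everything.
     Two neighbours of a vertex of such a copy with the same trace on it are
     twins, and few traces are possible, so that every vertex of one part has
     neighbours in at most two twin classes.
   Twin classes have at most p + q vertices, so they can be grouped into three
   sets of size at least q; every vertex of the other part misses one of them. *)

Set Implicit Arguments.
Unset Strict Implicit.
Unset Printing Implicit Defensive.

(** * Patterns as Boolean matrices: occurrence, transpose and complement *)

Definition mat (A B : Type) (e : A -> B -> bool) (s : seq A) (t : seq B) :=
  [seq [seq e a b | b <- t] | a <- s].

Definition avoids (A B : Type) (e : A -> B -> bool) (N : seq bitseq) :=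
  forall s t, mat e s t != N.

Definition transp (A B : Type) (e : A -> B -> bool) b a := e a b.
Definition compl (A B : Type) (e : A -> B -> bool) a b := ~~ e a b.

Definition transpm (M : seq bitseq) : seq bitseq :=
  [seq [seq nth false r j | r <- M] | j <- iota 0 (size (head [::] M))].

Lemma mat_transp (A B : Type) (e : A -> B -> bool) s t :
  0 < size s -> mat (transp e) t s = transpm (mat e s t).
Proof.
case: s => // a s _; rewrite /transpm /= size_map.
elim/last_ind: t => [|t b IH] //.
rewrite size_rcons -addn1 iotaD map_cat /= add0n /mat map_rcons -cats1.
congr (_ ++ [:: _]).
  rewrite -/(mat (transp e) t (a :: s)) IH; apply/eq_in_map => j.
  rewrite mem_iota add0n => /andP[_ jt]; congr cons.
    by rewrite map_rcons nth_rcons size_map jt.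
  rewrite -!map_comp; apply: eq_map => c /=.
  by rewrite map_rcons nth_rcons size_map jt.
rewrite map_rcons nth_rcons size_map ltnn eqxx; congr cons.
rewrite -map_comp; apply: eq_map => c /=.
by rewrite map_rcons nth_rcons size_map ltnn eqxx.
Qed.

Fixpoint words (T : Type) (k : nat) (s : seq T) : seq (seq T) :=
  if k is k'.+1 then [seq x :: l | x <- s, l <- words k' s] else [:: [::]].

Lemma mem_words (T : eqType) k (s l : seq T) : l \in words k s -> {subset l <= s}.
Proof.
elim: k l => [|k IH] l /=; first by rewrite inE => /eqP->.
case/allpairsP => -[x l'] /= [xs /IH l's ->] y.
by rewrite inE => /predU1P[->|/l's].
Qed.

Lemma size_words (T : eqType) k (s l : seq T) : l \in words k s -> size l = k.
Proof.
elim: k l => [|k IH] l /=; first by rewrite inE => /eqP->.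
by case/allpairsP => -[x l'] /= [_ /IH <- ->].
Qed.

Lemma sub_map_inv (T : eqType) (U : eqType) (f : T -> U) (s : seq T) L :
  {subset L <= map f s} -> exists2 s', {subset s' <= s} & map f s' = L.
Proof.
elim: L => [|y L IH] sL; first by exists [::].
have /mapP[x xs ->]: y \in map f s by apply: sL; rewrite mem_head.
have [|s' s's <-] := IH; first by move=> z zL; apply: sL; rewrite inE zL orbT.
by exists (x :: s') => // z; rewrite inE => /predU1P[->|/s's].
Qed.

(** These are the nonempty lists of rows of one common positive length, on which [transpm] is an
    involution; [transpm] reads the width off the first row. *)
Definition rect (N : seq bitseq) :=
  [&& 0 < size N, 0 < size (transpm N) & transpm (transpm N) == N].

(** Transposing turns the choice of columns into the choice of a preimage list, so [sub_map_inv]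
    yields [t']. *)
Lemma mat_cols (A B : eqType) (e : A -> B -> bool) s t N :
  rect N -> size s = size N -> {subset transpm N <= transpm (mat e s t)} ->
  exists2 t', {subset t' <= t} & mat e s t' = N.
Proof.
case/and3P => N0 C0 /eqP NN sN; rewrite -mat_transp ?sN // => /sub_map_inv[t' t't tN].
exists t' => //; rewrite -[RHS]NN -tN.
by rewrite -(@mat_transp _ _ (transp e)) // -(size_map (fun b =>
  [seq transp e b a | a <- s])) tN.
Qed.

(* The rows of M are chosen in order and with repetition, the columns of N are
   then looked up among the resulting columns: no injectivity is required, as the
   patterns used below have pairwise distinct rows and columns. *)
Definition containsb (M N : seq bitseq) :=
  has (fun rs => all (mem (transpm rs)) (transpm N)) (words (size N) M).

Lemma containsbP (A B : eqType) (e : A -> B -> bool) s t N :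
  rect N -> containsb (mat e s t) N ->
  exists s' t', [/\ {subset s' <= s}, {subset t' <= t} & mat e s' t' = N].
Proof.
move=> rN /hasP[rs rsM /allP /= sub].
have [s' s's E] := sub_map_inv (mem_words rsM).
have sz: size s' = size N by rewrite -(size_words rsM) -E size_map.
have subs: {subset transpm N <= transpm (mat e s' t)} by move=> c /sub; rewrite -E.
by have [t' t't Et] := mat_cols rN sz subs; exists s', t'.
Qed.

Definition bad (forb : seq (seq bitseq)) M := has (containsb M) forb.

Definition avoids_all (A B : Type) (e : A -> B -> bool) (forb : seq (seq bitseq)) :=
  forall N, N \in forb -> avoids e N.

Lemma not_bad (A B : eqType) (e : A -> B -> bool) forb s t :
  all rect forb -> avoids_all e forb -> bad forb (mat e s t) = false.
Proof.
move=> /allP rf av; apply/negbTE/negP => /hasP[N Nf].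
case/(containsbP (rf _ Nf)) => s' [t' [_ _ E]].
by have := av N Nf s' t'; rewrite E eqxx.
Qed.

Lemma avoids_sub (A B : eqType) (e : A -> B -> bool) M N :
  rect N -> containsb M N -> avoids e N -> avoids e M.
Proof.
move=> rN cMN av s t; apply/eqP => E; move: cMN; rewrite -E.
by case/(containsbP rN) => s' [t' [_ _ /eqP]]; apply/negP.
Qed.

Lemma avoids_transp (A B : eqType) (e : A -> B -> bool) N :
  rect N -> avoids e N -> avoids (transp e) (transpm N).
Proof.
case/and3P => N0 C0 /eqP NN av t s; apply/eqP => E.
have t0: 0 < size t by move: C0; rewrite -E size_map.
by have := av s t; rewrite -[mat e s t]/(mat (transp (transp e)) s t) mat_transp // E NN eqxx.
Qed.

Lemma mat_compl (A B : Type) (e : A -> B -> bool) s t :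
  mat (compl e) s t = map (map negb) (mat e s t).
Proof. by rewrite -map_comp; apply: eq_map => a /=; rewrite -map_comp. Qed.

Lemma avoids_compl (A B : eqType) (e : A -> B -> bool) N :
  avoids e N -> avoids (compl e) (map (map negb) N).
Proof.
move=> av s t; rewrite mat_compl; apply: contra (av s t) => /eqP E.
by apply/eqP/(inj_map (inj_map negb_inj)).
Qed.

(** * Relations without S_{1,2,3}, and indecomposable relations *)

(* S_{1,2,3} with the centre c in the row part: the rows are c, m', q and the
   columns l, m, p, r, where the legs are c-l, c-m-m' and c-p-q-r. *)
Definition skew : seq bitseq :=
  [:: [:: true; true; true; false]; [:: false; true; false; false];
      [:: false; false; true; true]].

Definition sfree (A B : Type) (e : A -> B -> bool) :=
  avoids e skew /\ avoids (transp e) skew.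

Lemma sfree_transp (A B : Type) (e : A -> B -> bool) : sfree e -> sfree (transp e).
Proof. by case. Qed.

(** S_{1,2,3} is its own bipartite complement, with the centre staying in the same part. *)
Lemma skew_compl (A B : eqType) (e : A -> B -> bool) :
  avoids e skew -> avoids (compl e) skew.
Proof. by move=> /avoids_compl; apply: avoids_sub. Qed.

Lemma sfree_compl (A B : eqType) (e : A -> B -> bool) :
  sfree e -> sfree (compl e).
Proof. by case=> /skew_compl ? /skew_compl. Qed.

(** The twelve hypotheses on adjacency are the entries of the pattern. They already make the
    vertices distinct, since [skew] has no repeated row or column. *)
Lemma sfree_spider (A B : Type) (e : A -> B -> bool) c l m m' p q r :
  sfree e ->
  e c l -> e c m -> e c p -> e m' m -> e q p -> e q r ->
  ~~ e c r -> ~~ e m' l -> ~~ e m' p -> ~~ e m' r -> ~~ e q l -> ~~ e q m ->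
  False.
Proof.
case=> av _ cl cm cp mm qp qr; have := av [:: c; m'; q] [:: l; m; p; r].
rewrite /mat /= cl cm cp mm qp qr.
by do 6!case: (e _ _) => //.
Qed.

(* s = t = false: e is disconnected; s = t = true: its bipartite complement is;
   s <> t: the orientation of all pairs, a -> b if adjacent and b -> a otherwise,
   is not strongly connected. *)
Definition indec (A B : finType) (e : A -> B -> bool) :=
  forall (X : {set A}) (Y : {set B}) s t,
    (forall a b, a \in X -> b \notin Y -> e a b = s) ->
    (forall a b, a \notin X -> b \in Y -> e a b = t) ->
    X = set0 /\ Y = set0 \/ X = setT /\ Y = setT.

Lemma indec_transp (A B : finType) (e : A -> B -> bool) : indec e -> indec (transp e).
Proof.
move=> ind X Y s t XY YX.
by case: (ind Y X t s) => [a b aY bX|a b aY bX|[-> ->]|[-> ->]];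
  [apply: YX|apply: XY|left|right].
Qed.

Lemma indec_compl (A B : finType) (e : A -> B -> bool) :
  indec e -> indec (compl e).
Proof.
move=> ind X Y s t XY YX; apply: (ind X Y (~~ s) (~~ t)) => a b ? ?.
  by rewrite -(XY a b) // negbK.
by rewrite -(YX a b) // negbK.
Qed.

(** * Mixed homogeneous pairs and the vertices around them *)

Definition row_module (A B : finType) (e : A -> B -> bool) (X : {set A}) (Y : {set B}) :=
  (forall a b b', a \notin X -> b \in Y -> b' \in Y -> e a b = e a b') /\
  (exists a b b', [/\ a \in X, b \in Y, b' \in Y, e a b & ~~ e a b']).

Definition mixed_module (A B : finType) (e : A -> B -> bool) X Y :=
  row_module e X Y /\ row_module (transp e) Y X.

Lemma mixed_module_transp (A B : finType) (e : A -> B -> bool) X Y :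
  mixed_module e X Y -> mixed_module (transp e) Y X.
Proof. by case. Qed.

Lemma row_module_compl (A B : finType) (e : A -> B -> bool) X Y :
  row_module e X Y -> row_module (compl e) X Y.
Proof.
case=> h [a [b [b' [aX bY b'Y ab ab']]]]; split=> [*|]; last first.
  by exists a, b', b; split=> //; rewrite /compl negbK.
by congr negb; apply: h.
Qed.

Lemma mixed_module_compl (A B : finType) (e : A -> B -> bool) X Y :
  mixed_module e X Y -> mixed_module (compl e) X Y.
Proof. by case=> /row_module_compl ? /row_module_compl. Qed.

Definition outer_anti (A B : finType) (e : A -> B -> bool) (X : {set A}) (Y : {set B}) a :=
  (a \notin X) && [forall (b | b \in Y), ~~ e a b].
Definition outer_full (A B : finType) (e : A -> B -> bool) (X : {set A}) (Y : {set B}) a :=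
  (a \notin X) && [forall (b | b \in Y), e a b].

Lemma outer_antiP (A B : finType) (e : A -> B -> bool) X Y a :
  outer_anti e X Y a -> a \notin X /\ (forall b, b \in Y -> ~~ e a b).
Proof. by case/andP=> aX /forall_inP. Qed.
Lemma outer_fullP (A B : finType) (e : A -> B -> bool) X Y a :
  outer_full e X Y a -> a \notin X /\ (forall b, b \in Y -> e a b).
Proof. by case/andP=> aX /forall_inP. Qed.

Lemma outer_cases (A B : finType) (e : A -> B -> bool) X Y a :
  row_module e X Y -> [|| a \in X, outer_anti e X Y a | outer_full e X Y a].
Proof.
case=> h [_ [b [_ [_ bY _ _ _]]]]; rewrite /outer_anti /outer_full.
case: (boolP (a \in X)) => //= aX.
case: (boolP (e a b)) => ab; apply/orP; [right|left]; apply/forall_inP => b' b'Y.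
  by rewrite (h a b' b).
by rewrite (h a b' b).
Qed.

Lemma outer_full_compl (A B : finType) (e : A -> B -> bool) X Y a :
  outer_full e X Y a = outer_anti (compl e) X Y a.
Proof. by congr andb; apply: eq_forallb => b; rewrite negbK. Qed.

(** In this and the next three lemmas a failure completes an induced S_{1,2,3} with the help of
    vertices of the pair. Here the legs are [t]-[b'], [t]-[b]-[a] and [t]-[z]-[x]-[z']. *)
Lemma outer_share (A B : finType) (e : A -> B -> bool) X Y t z z' x :
  sfree e -> mixed_module e X Y -> outer_full e X Y t -> outer_anti (transp e) Y X z ->
    outer_anti (transp e) Y X z' ->
  outer_anti e X Y x -> e x z -> e x z' -> e t z -> e t z'.
Proof.
move=> sf [[_ [a [b [b' [aX bY b'Y ab ab']]]]] _].
move=> /outer_fullP[_ tY] /outer_antiP[_ zX] /outer_antiP[_ z'X] /outer_antiP[_ xY] xz xz' tz.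
apply/negPn/negP => tz'.
by apply: (@sfree_spider _ _ e t b' b a z x z') => //;
  do ?[exact: tY|exact: xY|exact: zX|exact: z'X].
Qed.

(** This makes the full neighbours of [x1] and those of [x] comparable by inclusion. The legs are
    [a]-[b], [a]-[v']-[x] and [a]-[v]-[x1]-[z1]; if [x] sees [z1], [outer_share] applies to the
    transpose instead. *)
Lemma outer_nested (A B : finType) (e : A -> B -> bool) X Y x1 z1 v v' x :
  sfree e -> mixed_module e X Y -> outer_anti e X Y x1 -> outer_anti (transp e) Y X z1 ->
    e x1 z1 ->
  outer_full (transp e) Y X v -> outer_full (transp e) Y X v' -> outer_anti e X Y x ->
  e x1 v -> ~~ e x1 v' -> e x v' -> e x v.
Proof.
move=> sf hm x1m z1m x1z1 vp v'p xm x1v x1v' xv'.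
have [xz1|xz1] := boolP (e x z1).
  by case/negP: x1v'; apply: (@outer_share _ _ (transp e) Y X v' x x1 z1) => //;
    [exact: sfree_transp|exact: mixed_module_transp].
apply/negPn/negP => xv.
case: hm => [[_ [a [b [b' [aX bY b'Y ab ab']]]]] _].
move: x1m z1m vp v'p xm => /outer_antiP[_ x1Y] /outer_antiP[_ z1X] /outer_fullP[_ vX]
  /outer_fullP[_ v'X] /outer_antiP[_ xY].
by apply: (@sfree_spider _ _ e a b v' x v x1 z1) => //;
  do ?[exact: x1Y|exact: z1X|exact: vX|exact: v'X|exact: xY].
Qed.

Lemma outer_nonadj (A B : finType) (e : A -> B -> bool) X Y x z t v :
  sfree e -> mixed_module e X Y -> outer_anti e X Y x -> outer_anti (transp e) Y X z -> e x z ->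
  outer_full e X Y t -> outer_full (transp e) Y X v -> ~~ e t v -> e t z -> e x v.
Proof.
move=> sf hm xm zm xz tp vp tv tz; apply/negPn/negP => xv.
case: hm => [[_ [a [b [b' [aX bY b'Y ab ab']]]]] _].
move: xm zm vp tp => /outer_antiP[_ xY] /outer_antiP[_ zX] /outer_fullP[_ vX]
  /outer_fullP[_ tY].
by apply: (@sfree_spider _ _ e t b' z x b a v) => //;
  do ?[exact: xY|exact: zX|exact: vX|exact: tY].
Qed.

Lemma outer_adj (A B : finType) (e : A -> B -> bool) X Y x1 z1 x2 z2 t v :
  sfree e -> mixed_module e X Y -> outer_anti e X Y x1 -> outer_anti (transp e) Y X z1 ->
    e x1 z1 ->
  outer_anti e X Y x2 -> outer_anti (transp e) Y X z2 -> e x2 z2 ->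
  outer_full e X Y t -> outer_full (transp e) Y X v -> e t v ->
  e x1 v -> ~~ e x2 v -> e t z2 -> e t z1.
Proof.
move=> sf hm x1m z1m x1z1 x2m z2m x2z2 tp vp tv x1v x2v tz2.
have [x2z1|x2z1] := boolP (e x2 z1); first by apply: (outer_share sf hm tp z2m z1m x2m).
have [x1z2|x1z2] := boolP (e x1 z2); first by apply: (outer_share sf hm tp z2m z1m x1m).
apply/negPn/negP => tz1.
case: hm => [[_ [a [b [b' [aX bY b'Y ab ab']]]]] _].
move: x1m z1m x2m z2m vp tp => /outer_antiP[_ x1Y] /outer_antiP[_ z1X] /outer_antiP[_ x2Y]
  /outer_antiP[_ z2X] /outer_fullP[_ vX] /outer_fullP[_ tY].
by apply: (@sfree_spider _ _ e t b z2 x2 v x1 z1) => //;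
  do ?[exact: x1Y|exact: z1X|exact: x2Y|exact: z2X|exact: vX|exact: tY].
Qed.

(** * Mixed homogeneous pairs are everything *)

Definition outer_edge (A B : finType) (e : A -> B -> bool) X Y x z :=
  [/\ outer_anti e X Y x, outer_anti (transp e) Y X z & e x z].

Lemma outer_edge_transp (A B : finType) (e : A -> B -> bool) X Y x z :
  outer_edge e X Y x z -> outer_edge (transp e) Y X z x.
Proof. by case. Qed.

Definition full_nbrs (A B : finType) (e : A -> B -> bool) X Y x :=
  [set v | outer_full (transp e) Y X v & e x v].

Definition min_outer_edge (A B : finType) (e : A -> B -> bool) X Y x z :=
  outer_edge e X Y x z /\ forall x' z', outer_edge e X Y x' z' ->
    #|full_nbrs e X Y x| + #|full_nbrs (transp e) Y X z|
      <= #|full_nbrs e X Y x'| + #|full_nbrs (transp e) Y X z'|.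

Lemma min_outer_edge_transp (A B : finType) (e : A -> B -> bool) X Y x z :
  min_outer_edge e X Y x z -> min_outer_edge (transp e) Y X z x.
Proof.
case=> xz mn; split; first exact: outer_edge_transp.
by move=> z' x' /outer_edge_transp/mn; rewrite addnC [X in _ <= X]addnC.
Qed.

(** Otherwise nestedness makes the full neighbours of [x2] a proper subset of those of [x1], while
    [outer_adj] and [outer_nonadj] put those of [z2] among those of [z1], against minimality. *)
Lemma min_outer_edge_full_nbrs (A B : finType) (e : A -> B -> bool) X Y x1 z1 x2 z2 v :
  sfree e -> mixed_module e X Y -> min_outer_edge e X Y x1 z1 -> outer_edge e X Y x2 z2 ->
  outer_full (transp e) Y X v -> e x1 v -> e x2 v.
Proof.
move=> sf hm [[x1m z1m x1z1] mn] xz2 vp x1v; apply/negPn/negP => x2v.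
have [x2m z2m x2z2] := xz2.
have := mn _ _ xz2; rewrite leqNgt => /negP; apply.
rewrite -addSn; apply: leq_add.
  apply/proper_card/properP; split; last by exists v; rewrite inE vp.
  apply/subsetP => v'; rewrite !inE => /andP[v'p x2v']; rewrite v'p /=.
  apply/negPn/negP => x1v'; case/negP: x2v.
  exact: (outer_nested sf hm x1m z1m x1z1 vp v'p x2m).
apply/subset_leq_card/subsetP => t; rewrite !inE => /andP[tp tz2].
rewrite tp /=; have [tv|tv] := boolP (e t v).
  exact: (outer_adj sf hm x1m z1m x1z1 x2m z2m x2z2 tp vp tv).
by case/negP: x2v; apply: (outer_nonadj sf hm x2m z2m x2z2 tp vp tv).
Qed.

Definition loose (A B : finType) (e : A -> B -> bool) X Y x1 :=
  [set x | [&& outer_anti e X Y x, [forall (z | outer_anti (transp e) Y X z), ~~ e x z]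
             & full_nbrs e X Y x \subset full_nbrs e X Y x1]].

Lemma row_module_sub (A B : finType) (e : A -> B -> bool) (X X' : {set A}) (Y Y' : {set B}) :
  X \subset X' -> Y \subset Y' -> row_module e X Y ->
  (forall a b b', a \notin X' -> b \in Y' -> b' \in Y' -> e a b = e a b') ->
  row_module e X' Y'.
Proof.
move=> /subsetP XX /subsetP YY [_ [a [b [b' [aX bY b'Y ab ab']]]]] h.
by split=> //; exists a, b, b'; split; auto.
Qed.

(** A removed full neighbour of [z1] is complete to the remaining columns and a removed loose row is
    anticomplete to them. *)
Lemma row_module_grow (A B : finType) (e : A -> B -> bool) X Y x1 z1 :
  sfree e -> mixed_module e X Y -> min_outer_edge e X Y x1 z1 ->
  row_module e (~: (full_nbrs (transp e) Y X z1 :|: loose e X Y x1))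
         (~: (full_nbrs e X Y x1 :|: loose (transp e) Y X z1)).
Proof.
move=> sf hm mn; have [[x1m z1m x1z1] _] := mn.
apply: (@row_module_sub _ _ e X _ Y); [| |by case: hm|].
- by apply/subsetP => a aX; rewrite !inE negb_or /outer_full /outer_anti /= aX.
- by apply/subsetP => b bY; rewrite !inE negb_or /outer_full /outer_anti /= bY.
move=> a b b'; rewrite inE negbK in_setU => /orP[]; last first.
  rewrite inE => /and3P[am /forall_inP az /subsetP ar].
  suff ne c : c \in ~: (full_nbrs e X Y x1 :|: loose (transp e) Y X z1) -> e a c = false.
    by move=> /ne-> /ne->.
  rewrite inE in_setU negb_or => /andP[cr cl].
  case/or3P: (outer_cases c hm.2) => [cY|cm|cp].
  - by apply/negbTE; case/outer_antiP: am => _; apply.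
  - exact/negbTE/az.
  apply/negbTE/negP => ac; case/negP: cr; apply: ar.
  by rewrite inE cp.
rewrite inE => /andP[ap /= az1].
suff ne c : c \in ~: (full_nbrs e X Y x1 :|: loose (transp e) Y X z1) -> e a c.
  by move=> /ne-> /ne->.
rewrite inE in_setU negb_or => /andP[cr cl].
case/or3P: (outer_cases c hm.2) => [cY|cm|cp].
- by case/outer_fullP: ap => _; apply.
(* A non-neighbour [c] of [a] would be loose: an outer edge at [c] would force adjacency to [a] by
   minimality, and nestedness bounds its full neighbours. *)
- apply/negPn/negP => ac; case/negP: cl; rewrite inE cm /=; apply/andP; split.
    apply/forall_inP => x xm; apply/negP => /= xc; case/negP: ac.
    apply: (@min_outer_edge_full_nbrs _ _ (transp e) Y X z1 x1 c x a) => //;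
      [exact: sfree_transp|exact: mixed_module_transp|exact: min_outer_edge_transp].
  apply/subsetP => t; rewrite !inE => /andP[tp /= tc]; rewrite tp /=.
  apply/negPn/negP => tz1; case/negP: ac.
  apply: (@outer_nested _ _ (transp e) Y X z1 x1 a t c) => //;
    [exact: sfree_transp|exact: mixed_module_transp].
apply/negPn/negP => ac; case/negP: cr; rewrite inE cp /=.
exact: (outer_nonadj sf hm x1m z1m x1z1 ap cp ac).
Qed.

(* The full neighbours of a minimal outer edge are adjacent to every outer edge.
   Removing them, and the loose vertices, leaves a module larger than (X, Y); so
   there are none, and the component of the edge splits off. *)
Lemma no_outer_edge (A B : finType) (e : A -> B -> bool) X Y :
  sfree e -> indec e -> mixed_module e X Y ->
  (forall (X' : {set A}) (Y' : {set B}), #|X| < #|X'| -> mixed_module e X' Y' ->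
     X' = setT /\ Y' = setT) ->
  forall x z, ~ outer_edge e X Y x z.
Proof.
move=> sf ind hm IH x0 z0 xz0.
have [x1 [z1 mn]] : exists x1 z1, min_outer_edge e X Y x1 z1.
  pose F (u : A * B) := #|full_nbrs e X Y u.1| + #|full_nbrs (transp e) Y X u.2|.
  pose P (u : A * B) := [&& outer_anti e X Y u.1, outer_anti (transp e) Y X u.2 & e u.1 u.2].
  have P0: P (x0, z0) by apply/and3P; case: xz0.
  case: (arg_minnP F P0) => -[x1 z1] /and3P[/= ? ? ?] mn.
  exists x1, z1; split=> // x z [xm zm xz].
  by apply: (mn (x, z)); apply/and3P.
have [[x1m z1m x1z1] _] := mn.
set X' := ~: (full_nbrs (transp e) Y X z1 :|: loose e X Y x1).
set Y' := ~: (full_nbrs e X Y x1 :|: loose (transp e) Y X z1).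
have sX: X \subset X'.
  by apply/subsetP => a aX; rewrite !inE negb_or /outer_full /outer_anti /= aX.
have x1X': x1 \in X'.
  rewrite !inE negb_or; apply/andP; split.
    apply/negP => /andP[/outer_fullP[_ h]]; case: hm => -[_ [_ [b [_ [_ bY _ _ _]]]] _].
    by case/outer_antiP: x1m => _ /(_ b bY) /negP nb _; apply: nb; apply: h.
  apply/negP => /and3P[_ /forall_inP /(_ z1)]; rewrite x1z1 => h _.
  by have := h z1m.
have lX: #|X| < #|X'|.
  apply/proper_card/properP; split=> //; exists x1 => //.
  by case/outer_antiP: x1m.
have [] := IH X' Y' lX.
  split; first exact: row_module_grow.
  by apply: row_module_grow; [exact: sfree_transp|exact: mixed_module_transp|exact:
    min_outer_edge_transp].
move=> EX EY.
pose nx x := [forall (v | outer_full (transp e) Y X v), ~~ e x v].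
pose nz z := [forall (t | outer_full e X Y t), ~~ e t z].
have nx1: nx x1.
  apply/forall_inP => v vp; apply/negP => x1v.
  by have := in_setT v; rewrite -EY !inE vp x1v.
have nz1: nz z1.
  apply/forall_inP => t tp; apply/negP => tz1.
  by have := in_setT t; rewrite -EX !inE tp /= /transp tz1.
(* These are the ends of outer edges without full neighbours at either end. By [outer_share] that
   property spreads along outer edges, so no edge leaves ([CX], [CZ]). *)
pose CX := [set x | [&& outer_anti e X Y x, nx x & [exists z, [&& outer_anti (transp e) Y X
  z, nz z & e x z]]]].
pose CZ := [set z | [&& outer_anti (transp e) Y X z, nz z &
  [exists x, [&& outer_anti e X Y x, nx x & e x z]]]].
have x1C: x1 \in CX.
  by rewrite inE x1m nx1; apply/existsP; exists z1; rewrite z1m nz1.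
have z1C: z1 \in CZ.
  by rewrite inE z1m nz1; apply/existsP; exists x1; rewrite x1m nx1.
case: (ind CX CZ false false) => [a b|a b|[E _]|[E _]].
- rewrite !inE => /and3P[am na /existsP[z /and3P[zm nzz az]]] bC.
  apply/negbTE/negP => ab; case/negP: bC.
  case/or3P: (outer_cases b hm.2) => [bY|bm|bp].
  + by case/outer_antiP: am => _ /(_ _ bY); rewrite ab.
  + apply/and3P; split=> //; last by apply/existsP; exists a; rewrite am na.
    apply/forall_inP => t tp; apply/negP => tb.
    by have := forall_inP nzz t tp; rewrite (outer_share sf hm tp bm zm am).
  by have := forall_inP na b bp; rewrite ab.
- rewrite !inE => aC /and3P[bm nb /existsP[x /and3P[xm nxx xb]]].
  apply/negbTE/negP => ab; case/negP: aC.
  case/or3P: (outer_cases a hm.1) => [aX|am|ap].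
  + by case/outer_antiP: bm => _ /(_ _ aX); rewrite /transp ab.
  + apply/and3P; split=> //; last by apply/existsP; exists b; rewrite bm nb.
    apply/forall_inP => v vp; apply/negP => av.
    case/negP: (forall_inP nxx v vp).
    exact: (@outer_share _ _ (transp e) Y X v a x b (sfree_transp sf) (mixed_module_transp hm)).
  by have := forall_inP nb a ap; rewrite ab.
- by rewrite E inE in x1C.
have [[_ [a [_ [_ [aX _ _ _ _]]]]] _] := hm.
by have := in_setT a; rewrite -E inE /outer_anti aX.
Qed.

(** Induction on the number of rows outside. By [no_outer_edge], for [e] and for its complement,
    outer anti vertices are anticomplete to each other and outer full ones complete. So full rows
    with anti columns, and anti rows with full columns, are cuts, and both are empty. *)
Lemma mixed_module_full (A B : finType) (e : A -> B -> bool) X Y :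
  sfree e -> indec e -> mixed_module e X Y -> X = setT /\ Y = setT.
Proof.
move=> sf ind.
have [n] := ubnP (#|A| - #|X|); elim: n => // n IHn in X Y * => lt_n hm.
have IH (X' : {set A}) (Y' : {set B}) : #|X| < #|X'| -> mixed_module e X' Y' ->
    X' = setT /\ Y' = setT.
  move=> lX; apply: IHn; apply: leq_trans (_ : #|A| - #|X| <= n); last by rewrite -ltnS.
  by rewrite ltn_sub2l // (leq_trans lX) ?max_card.
have M := no_outer_edge sf ind hm IH.
have Pl x z : outer_full e X Y x -> outer_full (transp e) Y X z -> e x z.
  move=> xp zp; apply/negPn/negP => xz.
  apply: (@no_outer_edge _ _ (compl e) X Y _ _ _ _ x z).
  - exact: sfree_compl.
  - exact: indec_compl.
  - exact: mixed_module_compl.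
  - move=> X' Y' lX /mixed_module_compl h; apply: (IH X' Y') => //.
    case: h => -[h1 h2] [h3 h4].
    split; split.
    + by move=> a b b' *; have := h1 a b b'; rewrite /compl !negbK; apply.
    + by case: h2 => a [b [b' h]]; exists a, b, b'; rewrite /compl !negbK in h.
    + by move=> a b b' *; have := h3 a b b'; rewrite /compl /transp !negbK; apply.
    + by case: h4 => a [b [b' h]]; exists a, b, b'; rewrite /compl /transp !negbK in h *.
  by split=> //; rewrite -outer_full_compl.
have [[_ [a0 [b0 [_ [aX bY _ _ _]]]]] _] := hm.
have Mn x z : outer_anti e X Y x -> outer_anti (transp e) Y X z -> e x z = false.
  by move=> xm zm; apply/negbTE/negP => xz; apply: (M x z).
have [eP eM] : [set a | outer_full e X Y a] = set0 /\ [set b | outer_anti (transp e) Y X b]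
  = set0.
  case: (ind [set a | outer_full e X Y a] [set b | outer_anti (transp e) Y X b] true false)
    => //.
  - move=> a b; rewrite !inE => ap bm.
    case/or3P: (outer_cases b hm.2) => [bY'|bm'|bp]; last exact: Pl.
      by case/outer_fullP: ap => _ ->.
    by rewrite bm' in bm.
  - move=> a b; rewrite !inE => ap bm.
    case/or3P: (outer_cases a hm.1) => [aX'|am|ap']; last by rewrite ap' in ap.
      by apply/negbTE; case/outer_antiP: bm => _; apply.
    exact: Mn.
  by case=> E _; have := in_setT a0; rewrite -E inE /outer_full aX.
have [eM' eP'] : [set a | outer_anti e X Y a] = set0 /\ [set b | outer_full (transp e) Y X
  b] = set0.
  case: (ind [set a | outer_anti e X Y a] [set b | outer_full (transp e) Y X b] false true)
    => //.
  - move=> a b; rewrite !inE => am bp.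
    case/or3P: (outer_cases b hm.2) => [bY'|bm'|bp']; last by rewrite bp' in bp.
      by apply/negbTE; case/outer_antiP: am => _; apply.
    exact: Mn.
  - move=> a b; rewrite !inE => am bp.
    case/or3P: (outer_cases a hm.1) => [aX'|am'|ap']; last exact: Pl.
      by case/outer_fullP: bp => _; apply.
    by rewrite am' in am.
  by case=> E _; have := in_setT a0; rewrite -E inE /outer_anti aX.
split; apply/setP => u; rewrite in_setT.
  case/or3P: (outer_cases u hm.1) => // h.
    by have := in_set0 u; rewrite -eM' inE h.
  by have := in_set0 u; rewrite -eP inE h.
case/or3P: (outer_cases u hm.2) => // h.
  by have := in_set0 u; rewrite -eM inE h.
by have := in_set0 u; rewrite -eP' inE h.
Qed.

(** * Existence of an induced P7 *)

Definition path6 : seq bitseq :=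
  [:: [:: true; false; false]; [:: true; true; false]; [:: false; true; true]].
Definition path7 : seq bitseq :=
  [:: [:: true; false; false]; [:: true; true; false];
      [:: false; true; true]; [:: false; false; true]].

(* G[X, Y] has edges in two different components: f and g are the vertices of one
   colour in a colouring where all edges are monochromatic. *)
Definition bicolored (A B : finType) (e : A -> B -> bool)
    (X : {set A}) (Y : {set B}) (f : {set A}) (g : {set B}) :=
  [/\ forall a b, a \in X -> b \in Y -> e a b -> (a \in f) = (b \in g),
      exists a b, [/\ a \in X, b \in Y, e a b & a \in f]
    & exists a b, [/\ a \in X, b \in Y, e a b & a \notin f]].

Definition splittable (A B : finType) (e : A -> B -> bool) X Y :=
  exists f g, bicolored e X Y f g.

Lemma splittable_transp (A B : finType) (e : A -> B -> bool) X Y :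
  splittable e X Y -> splittable (transp e) Y X.
Proof.
case=> f [g [h [a [b [aX bY ab af]]] [a' [b' [aX' bY' ab' af']]]]].
exists g, f; split=> [b0 a0 b0Y a0X ab0||]; first by rewrite (h a0 b0).
  by exists b, a; rewrite -(h a b).
by exists b', a'; rewrite -(h a' b').
Qed.

Lemma bicoloredC (A B : finType) (e : A -> B -> bool) X Y f g :
  bicolored e X Y f g -> bicolored e X Y (~: f) (~: g).
Proof.
case=> h [a [b [aX bY ab af]]] [a' [b' [aX' bY' ab' af']]]; split.
- by move=> a0 b0 aX0 bY0 ab0; rewrite !inE (h a0 b0).
- by exists a', b'; rewrite inE.
by exists a, b; rewrite inE negbK.
Qed.

(* v is joined to the path b - a - b' in one colour and to the edge c c' in the
   other, so that c - c' - v - b - a - b' is an induced P6. *)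
Definition attached (A B : finType) (e : A -> B -> bool) X Y v f g b a b' c c' :=
  [/\ bicolored e X Y f g, [/\ a \in X, a \in f, c \in X & c \notin f],
      [/\ b \in Y, b' \in Y & c' \in Y], [/\ e a b, e a b' & e c c']
    & [/\ e v b, ~~ e v b' & e v c']].

(** If part of the configuration were absent, a suitable colouring would split the pair enlarged by
    [v]. *)
Lemma attach (A B : finType) (e : A -> B -> bool) X Y v a0 b0 :
  splittable e X Y -> v \notin X -> ~ splittable e (v |: X) Y ->
  a0 \in X -> b0 \in Y -> e a0 b0 -> ~~ e v b0 ->
  exists f g b a b' c c', attached e X Y v f g b a b' c c'.
Proof.
move=> [f [g fg]] vX nsp a0X b0Y ab0 vb0.
have [/existsP[b1 /andP[b1Y vb1]]|nov] := boolP [exists b, (b \in Y) && e v b]; last first.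
  case: nsp; exists f, g; case: fg => h [a [b [aX bY ab af]]] [a' [b' [aX' bY' ab' af']]].
  split; last 2 first.
  - by exists a, b; rewrite setU1r.
  - by exists a', b'; rewrite setU1r.
  move=> x y; rewrite in_setU1 => /predU1P[->|xX] yY xy; last exact: h.
  by case/existsP: nov; exists y; rewrite yY.
(* If no row sees both a neighbour and a non-neighbour of [v], adjacency to [v] is itself a
   colouring, with [b0] and [b1] in different colours. *)
have [/existsP[a /andP[aX /existsP[b /existsP[b' /and5P[/andP[bY b'Y] ab ab' vb vb']]]]]|no3] :=
  boolP [exists a, (a \in X) && [exists b, [exists b',
    [&& (b \in Y) && (b' \in Y), e a b, e a b', e v b & ~~ e v b']]]]; last first.
  case: nsp; exists [set a in X | [exists b in Y, e a b && ~~ e v b]], [set b in Y | ~~ e v b].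
  split; last 2 first.
  - exists a0, b0; rewrite setU1r // inE a0X; split=> //.
    by apply/exists_inP; exists b0; rewrite ?ab0.
  - by exists v, b1; rewrite setU11 inE (negbTE vX).
  move=> x y; rewrite in_setU1 => /predU1P[->|xX] yY xy.
    by rewrite !inE (negbTE vX) xy andbF.
  rewrite !inE xX yY /=; apply/exists_inP/idP => [[z zY /andP[xz vz]]|vy].
    apply: contraNN no3 => vy; apply/existsP; exists x; rewrite xX.
    by apply/existsP; exists y; apply/existsP; exists z; rewrite yY zY xy xz vy.
  by exists y => //; rewrite xy.
wlog af: f g fg / a \in f.
  move=> W; have [|af] := boolP (a \in f); first exact: W fg.
  by apply: W (bicoloredC fg) _; rewrite inE.
have [h _ [a2 [b2 [a2X b2Y ab2 a2f]]]] := fg.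
have [/existsP[c /existsP[c' /and4P[/andP[cX c'Y] cf cc vc]]]|noc] :=
  boolP [exists c, [exists c', [&& (c \in X) && (c' \in Y), c \notin f, e c c' & e v c']]].
  by exists f, g, b, a, b', c, c'.
(* Here [v] takes the colour of [a], and so do the columns isolated from [X], which may be
   neighbours of [v]. *)
case: nsp; exists (v |: f), [set y in Y | (y \in g) || [forall (x | x \in X), ~~ e x y]].
split.
- move=> x y; rewrite !inE => /predU1P[->|xX] yY xy.
    rewrite eqxx yY /=; apply/esym/negPn/negP; rewrite negb_or => /andP[yg].
    rewrite negb_forall => /existsP[c]; rewrite negb_imply negbK => /andP[cX cy].
    case/negP: noc; apply/existsP; exists c; apply/existsP; exists y.
    by rewrite cX yY cy xy (h c y) ?yg.
  rewrite yY /= (h x y) //; have [xv|_] /= := eqVneq x v.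
    by rewrite -xv xX in vX.
  case: (y \in g) => //=; apply/esym/negbTE; rewrite negb_forall; apply/existsP.
  by exists x; rewrite xX xy.
- by exists a, b; rewrite !setU1r.
exists a2, b2; rewrite setU1r // in_setU1 negb_or a2f andbT; split=> //.
by apply: contraNneq vX => <-.
Qed.

Definition nonisolated (A B : finType) (e : A -> B -> bool) (X : {set A}) (Y : {set B}) :=
  [set a in X | [exists b in Y, e a b]].

(** An outside row is either an isolated row of [X] or complete by hypothesis; [a] is mixed because
    it misses [b'], which has the other colour. *)
Lemma row_module_nonisolated (A B : finType) (e : A -> B -> bool) X Y :
  splittable e X Y ->
  (forall v b, v \notin X -> b \in nonisolated (transp e) Y X -> e v b) ->
  row_module e (nonisolated e X Y) (nonisolated (transp e) Y X).
Proof.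
move=> [f [g [h [a [b [aX bY ab af]]] [a' [b' [a'X b'Y ab' af']]]]]] H; split.
  suff ne v b1 b2 : v \notin nonisolated e X Y -> b1 \in nonisolated (transp e) Y X ->
      b2 \in nonisolated (transp e) Y X -> e v b1 -> e v b2.
    by move=> v b1 b2 *; apply/idP/idP; apply: ne.
  move=> vI b1I b2I vb; have [vX|/H->//] := boolP (v \in X).
  move: b1I vI; rewrite !inE vX => /andP[b1Y _] /exists_inP[].
  by exists b1.
exists a, b, b'; rewrite !inE aX bY b'Y; split=> //.
- by apply/exists_inP; exists b.
- by apply/exists_inP; exists a.
- by apply/exists_inP; exists a'.
by apply: contra af' => ab2; rewrite (h a' b') // -(h a b').
Qed.

Lemma nonisolated_complete (A B : finType) (e : A -> B -> bool) X Y :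
  sfree e -> indec e -> splittable e X Y ->
  (forall v b, v \notin X -> b \in nonisolated (transp e) Y X -> e v b) ->
  (forall v a, v \notin Y -> a \in nonisolated e X Y -> e a v) -> False.
Proof.
move=> sf ind sp HX HY.
have [EX EY] := mixed_module_full sf ind (conj (row_module_nonisolated sp HX)
  (row_module_nonisolated (splittable_transp sp) HY)).
have X1 a : a \in X by have := in_setT a; rewrite -EX inE => /andP[].
have Y1 b : b \in Y by have := in_setT b; rewrite -EY inE => /andP[].
case: sp => f [g [h [a [b [aX bY ab af]]] [a' [b' [a'X b'Y ab' af']]]]].
case: (ind f g false false) => [x y xf yg|x y xf yg|[E _]|[E _]].
- by apply/negbTE/negP => xy; rewrite (h x y) in xf => //; rewrite xf in yg.
- by apply/negbTE/negP => xy; rewrite (h x y) in xf => //; rewrite yg in xf.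
- by rewrite E inE in af.
by rewrite E inE in af'.
Qed.

(* In a maximal splittable pair on which no outside vertex is mixed, the
   non-isolated vertices form a mixed module. *)
Lemma splittable_absurd (A B : finType) (e : A -> B -> bool) (X0 : {set A}) (Y0 : {set B}) :
  sfree e -> indec e ->
  (forall (X : {set A}) (Y : {set B}) v f g b a b' c c', X0 \subset X -> Y0 \subset Y ->
    v \notin X ->
     ~ splittable e (v |: X) Y -> attached e X Y v f g b a b' c c' -> False) ->
  (forall (X : {set A}) (Y : {set B}) v f g b a b' c c', X0 \subset X -> Y0 \subset Y ->
    v \notin Y ->
     ~ splittable (transp e) (v |: Y) X -> attached (transp e) Y X v f g b a b' c c' ->
       False) ->
  ~ splittable e X0 Y0.
Proof.
move=> sf ind HA HB.
suff G n (X : {set A}) (Y : {set B}) : #|~: X| + #|~: Y| < n -> X0 \subset X ->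
  Y0 \subset Y -> ~ splittable e X Y.
  exact: (G _.+1 _ _ (leqnn _)).
elim: n => // n IHn in X Y *; rewrite ltnS => lt_n sX sY sp.
have maxX v : v \notin X -> ~ splittable e (v |: X) Y.
  move=> vX; apply: IHn => //; last exact: (subset_trans sX (subsetUr _ _)).
  apply: leq_trans lt_n; rewrite ltn_add2r.
  by apply: proper_card; rewrite properC properUr // sub1set.
have maxY v : v \notin Y -> ~ splittable e X (v |: Y).
  move=> vY; apply: IHn => //; last exact: (subset_trans sY (subsetUr _ _)).
  apply: leq_trans lt_n; rewrite ltn_add2l.
  by apply: proper_card; rewrite properC properUr // sub1set.
apply: (nonisolated_complete sf ind sp) => v u vX; rewrite inE =>
  /andP[uY /exists_inP[w wX uw]].
  apply/negPn/negP => vu.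
  have [f [g [b [a [b' [c [c' H]]]]]]] := attach sp vX (maxX v vX) wX uY uw vu.
  exact: (HA _ _ _ _ _ _ _ _ _ _ sX sY vX (maxX v vX) H).
apply/negPn/negP => vu.
have nsp: ~ splittable (transp e) (v |: Y) X by move=> /splittable_transp; apply: maxY.
have [f [g [b [a [b' [c [c' H]]]]]]] := attach (splittable_transp sp) vX nsp wX uY uw vu.
exact: (HB _ _ _ _ _ _ _ _ _ _ sX sY vX nsp H).
Qed.

Lemma attached_path6 (A B : finType) (e : A -> B -> bool) X Y v f g b a b' c c' :
  attached e X Y v f g b a b' c c' -> ~ avoids e path6.
Proof.
move=> [[h _ _] [aX af cX cf] [bY b'Y c'Y] [ab ab' cc'] [vb vb' vc']].
move=> /(_ [:: c; v; a] [:: c'; b; b']); rewrite /mat /= ab ab' cc' vb (negbTE vb') vc'.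
have n1 : e c b = false.
  by apply/negbTE; apply: contra cf => cb; rewrite (h c b) // -(h a b).
have n2 : e c b' = false.
  by apply/negbTE; apply: contra cf => cb; rewrite (h c b') // -(h a b').
have n3 : e a c' = false.
  by apply/negbTE; apply: contra cf => cb; rewrite (h c c') // -(h a c').
by rewrite n1 n2 n3.
Qed.

(** Take a row [a] of maximum degree, a non-neighbour [b] of [a] and a neighbour [a2] of [b]: by
    maximality [a] has a neighbour that [a2] misses. Indecomposability excludes full rows and empty
    columns. *)
Lemma ex_2K2 (A B : finType) (e : A -> B -> bool) (a0 : A) (b0 : B) :
  indec e -> exists a1 b1 a2 b2,
  [/\ e a1 b1, e a2 b2, ~~ e a1 b2 & ~~ e a2 b1].
Proof.
move=> ind; pose N a := [set b | e a b].
case: (@arg_maxnP _ a0 predT (fun a => #|N a|) isT) => a _ mx.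
have [/existsP[b ab]|] := boolP [exists b, ~~ e a b]; last first.
  rewrite negb_exists => /forallP aT.
  case: (ind [set a] set0 true true) => [x y /set1P-> _|x y _|[/setP/(_ a)]|[_ /setP/(_ b0)]].
  - by have := aT y; rewrite negbK.
  - by rewrite inE.
  - by rewrite !inE eqxx.
  by rewrite !inE.
have [/existsP[a2 a2b]|] := boolP [exists x, e x b]; last first.
  rewrite negb_exists => /forallP bN.
  case: (ind set0 [set b] true false) => [x y|x y _ /set1P->|[_ /setP/(_ b)]|[/setP/(_ a0)]].
  - by rewrite in_set0.
  - exact/negbTE/bN.
  - by rewrite !inE eqxx.
  by rewrite !inE.
have /subsetPn[b1]: ~~ (N a \subset N a2).
  apply/negP => s; have := mx a2 isT; rewrite /= leqNgt => /negP; apply.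
  apply/proper_card/properP; split=> //; exists b; rewrite inE //.
by rewrite !inE => ab1 a2b1; exists a, b1, a2, b.
Qed.

Lemma avoids_path6_transp (A B : eqType) (e : A -> B -> bool) :
  avoids e path6 -> avoids (transp e) path6.
Proof. by move=> /(@avoids_transp _ _ e path6 isT); apply: avoids_sub. Qed.

(** An induced 2K2 is a splittable pair, and an attachment to a maximal extension of it contains
    P6. *)
Lemma path6_ex (A B : finType) (e : A -> B -> bool) (a0 : A) (b0 : B) :
  sfree e -> indec e -> ~ avoids e path6.
Proof.
move=> sf ind av.
have [a1 [b1 [a2 [b2 [ab1 ab2 nab1 nab2]]]]] := ex_2K2 a0 b0 ind.
apply: (@splittable_absurd _ _ e [set a1; a2] [set b1; b2] sf ind).
- by move=> X Y v f g b a b' c c' _ _ _ _ /attached_path6/(_ av).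
- by move=> X Y v f g b a b' c c' _ _ _ _ /attached_path6/(_ (avoids_path6_transp av)).
have a12: a2 == a1 = false by apply/negbTE; apply: contraNneq nab2 => ->.
have b12: b2 == b1 = false by apply/negbTE; apply: contraNneq nab1 => ->.
exists [set a1], [set b1]; split.
- by move=> x y /set2P[] -> /set2P[] ->; rewrite !inE ?eqxx ?a12 ?b12 // => H;
    rewrite H in nab1 nab2.
- by exists a1, b1; rewrite !inE !eqxx.
by exists a2, b2; rewrite !inE !eqxx a12 !orbT.
Qed.

(* The component of a in G[X, Y] is complete bipartite and v is complete to the
   other components, so that no component can contain the P4 a1 - b1 - a2 - b2. *)
Lemma attached_path4 (A B : finType) (e : A -> B -> bool) (X : {set A}) (Y :
  {set B}) v f g b a b' c c'
    a1 a2 b1 b2 :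
  sfree e -> avoids e path7 -> avoids (transp e) path7 ->
  v \notin X -> ~ splittable e (v |: X) Y ->
  attached e X Y v f g b a b' c c' ->
  a1 \in X -> a2 \in X -> b1 \in Y -> b2 \in Y ->
  e a1 b1 -> e a2 b1 -> e a2 b2 -> ~~ e a1 b2 -> False.
Proof.
move=> sf av av' vX nsp [[h _ _] [aX af cX cf] [bY b'Y c'Y] [ab ab' cc'] [vb vb' vc']].
move=> a1X a2X b1Y b2Y ab1 ab21 ab2 nab.
have bg: b \in g by rewrite -(h a b).
have c'g: c' \notin g by rewrite -(h c c').
have sep x y : x \in X -> y \in Y -> (x \in f) != (y \in g) -> ~~ e x y.
  by move=> xX yY; apply: contraNN => xy; rewrite (h x y).
have sep1 x y : x \in X -> y \in Y -> x \in f -> y \notin g -> e x y = false.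
  by move=> *; apply/negbTE/sep => //; apply: contraNneq (_ : y \notin g) => // <-.
have sep2 x y : x \in X -> y \in Y -> x \notin f -> y \in g -> e x y = false.
  by move=> *; apply/negbTE/sep => //; apply: contraNneq (_ : x \notin f) => // ->.
(* [Fa] and [F1] rest on an S_{1,2,3} and [FP] on a P7, all using the path [v]-[c']-[c] into the
   other colour. *)
have Fa r n m n' : r \in X -> n \in Y -> m \in Y -> n' \in Y -> n \in g -> n' \in g ->
    e v n -> e r n -> e r m -> ~~ e v m -> e v n' -> e r n'.
  move=> rX nY mY n'Y ng n'g vn rn rm vm vn'; apply/negPn/negP => rn'.
  have rf: r \in f by rewrite (h r n).
  have mg: m \in g by rewrite -(h r m).
  by apply: (@sfree_spider _ _ e v n' c' c n r m) => //; apply: sep => //;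
    rewrite ?rf ?mg ?ng ?n'g ?(negbTE cf) ?(negbTE c'g).
have F1 r x n m : r \in X -> x \in X -> n \in Y -> m \in Y -> n \in g ->
    e v n -> e x n -> e x m -> ~~ e v m -> e r n -> e r m.
  move=> rX xX nY mY ng vn xn xm vm rn; apply/negPn/negP => nrm.
  have rf: r \in f by rewrite (h r n).
  have xf: x \in f by rewrite (h x n).
  have mg: m \in g by rewrite -(h x m).
  by apply: (@sfree_spider _ _ (transp e) n r x m v c' c) => //; do 1?[exact: sfree_transp];
    apply: sep => //; rewrite ?rf ?mg ?ng ?xf ?(negbTE cf) ?(negbTE c'g).
have FP x n m r : x \in X -> n \in Y -> m \in Y -> r \in X -> n \in g ->
    e v n -> e x n -> e x m -> ~~ e v m -> e r m -> e r n.
  move=> xX nY mY rX ng vn xn xm vm rm; apply/negPn/negP => rn.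
  have xf: x \in f by rewrite (h x n).
  have mg: m \in g by rewrite -(h x m).
  have rf: r \in f by rewrite (h r m).
  have := av [:: c; v; x; r] [:: c'; n; m].
  rewrite /mat /= cc' vc' vn (negbTE vm) xn xm rm (negbTE rn).
  by rewrite (sep2 c n) // (sep2 c m) // (sep1 x c') // (sep1 r c').
(* [A1] and the later [B1] form the component of [a]: they are complete to each other by [F2] and
   [F4], and closed under adjacency by [clos]. *)
pose A1 := [set r in X | [exists n in Y, [&& n \in g, e v n & e r n]]].
pose M1 := [set m in Y | ~~ e v m && [exists r in A1, e r m]].
have F2 r n : r \in A1 -> n \in Y -> n \in g -> e v n -> e r n.
  rewrite inE => /andP[rX /exists_inP[n0 n0Y /and3P[n0g vn0 rn0]]] nY ng vn.
  have an0: e a n0 by apply: (Fa a b b' n0).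
  apply: (Fa r n0 b' n) => //.
  exact: (F1 r a n0 b').
have A1X r : r \in A1 -> r \in X by rewrite inE => /andP[].
have F3 x m : x \in X -> m \in M1 -> e x m -> x \in A1.
  move=> xX; rewrite inE => /and3P[mY vm /exists_inP[r rA rm]] xm.
  rewrite inE xX; apply/exists_inP; exists b; rewrite // bg vb /=.
  by apply: (FP r b m x) => //; [apply: A1X|apply: F2].
have F4 r m : r \in A1 -> m \in M1 -> e r m.
  move=> rA; rewrite inE => /and3P[mY vm /exists_inP[x xA xm]].
  by apply: (F1 r x b m) => //; [apply: A1X|apply: A1X|apply: F2|apply: F2].
pose B1 := M1 :|: [set n in Y | (n \in g) && e v n].
have inB1 y : (y \in B1) = (y \in M1) || [&& y \in Y, y \in g & e v y].
  by rewrite in_setU [y \in [set _ in _ | _]]in_set.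
clearbody B1.
have clos x y : x \in X -> y \in Y -> e x y -> (x \in f) -> (x \in A1) = (y \in B1).
  move=> xX yY xy xf; have yg: y \in g by rewrite -(h x y).
  apply/idP/idP => [xA|].
    rewrite inB1 yY yg /= in_set yY; case: (boolP (e v y)) => //= _.
    by rewrite orbF; apply/exists_inP; exists x.
  rewrite inB1 => /orP[yM|/and3P[_ _ vy]]; first exact: (F3 x y).
  rewrite inE; rewrite xX; apply/exists_inP; exists y => //.
  by rewrite yg vy.
have aA: a \in A1.
  by rewrite inE aX; apply/exists_inP; exists b => //; rewrite bg vb.
clearbody A1.
(* Non-isolated rows of this colour outside [A1] would lie in components not touched by [v], which
   could be coloured apart. *)
have inA x y : x \in X -> y \in Y -> e x y -> x \in f -> x \in A1.
  move=> xX yY xy xf; apply/negPn/negP => xA; case: nsp.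
  exists [set x in X | (x \in f) && (x \notin A1)],
    [set y in Y | (y \in g) && (y \notin B1)].
  split.
  - move=> x' y'; rewrite in_setU1 !in_set => /predU1P[->|x'X] y'Y xy'.
      rewrite (negbTE vX) y'Y /=; case: (boolP (y' \in g)) => //= y'g.
      by rewrite inB1 y'Y y'g xy' orbT.
    rewrite x'X y'Y (h x' y') //=; case: (boolP (y' \in g)) => //= y'g.
    by rewrite (clos x' y') ?(h x' y').
  - by exists x, y; rewrite setU1r // in_set xX xf.
  by exists a, b; rewrite setU1r // in_set aA !andbF.
(* A path in the colour of [a] contradicts the completeness of the component. Otherwise [v] sees
   both [b1] and [b2] and is the centre of an S_{1,2,3}. *)
have [a1f|a1f] := boolP (a1 \in f).
  have a2f: a2 \in f by rewrite (h a2 b1) // -(h a1 b1).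
  have a2A: a2 \in A1 by apply: (inA a2 b2).
  have a1A: a1 \in A1 by apply: (inA a1 b1).
  have b2B: b2 \in B1 by rewrite -(clos a2 b2).
  case/negP: nab; move: b2B; rewrite inB1 => /orP[|]; first exact: F4.
  by case/and3P; apply: F2.
(* Otherwise [b']-[a]-[b]-[v]-[n]-[r]-[m] is an induced P7. *)
have FQ r n m : r \in X -> n \in Y -> m \in Y -> r \notin f ->
    e v n -> e r n -> e r m -> e v m.
  move=> rX nY mY rf vn rn rm; apply/negPn/negP => vm.
  have ng: n \notin g by rewrite -(h r n).
  have mg: m \notin g by rewrite -(h r m).
  have b'g: b' \in g by rewrite -(h a b').
  have := av' [:: b'; b; n; m] [:: a; v; r].
  rewrite /mat /= /transp ab ab' vb (negbTE vb') vn (negbTE vm) rn rm.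
  by rewrite (sep2 r b') // (sep2 r b) // (sep1 a n) // (sep1 a m).
have vall x y : x \in X -> y \in Y -> e x y -> x \notin f -> e v y.
  move=> xX yY xy xf; apply/negPn/negP => vy; case: nsp.
  exists [set x in X | (x \notin f) && [exists m in Y, e x m && ~~ e v m]],
    [set y in Y | (y \notin g) && ~~ e v y].
  split.
  - move=> x' y'; rewrite in_setU1 !in_set => /predU1P[->|x'X] y'Y xy'.
      by rewrite (negbTE vX) y'Y xy' /= andbF.
    rewrite x'X y'Y (h x' y') //=; case: (boolP (y' \in g)) => //= y'g.
    apply/exists_inP/idP => [[m mY /andP[xm vm]]|vy'].
      apply: contra vm => vy'; apply: (FQ x' y' m) => //.
      by rewrite (h x' y').
    by exists y' => //; rewrite xy'.
  - exists x, y; rewrite setU1r // inE xX xf; split=> //=.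
    by apply/exists_inP; exists y => //; rewrite xy.
  by exists a, b; rewrite setU1r // in_set af andbF.
have b1g: b1 \notin g by rewrite -(h a1 b1).
have a2f: a2 \notin f by rewrite (h a2 b1).
have b2g: b2 \notin g by rewrite -(h a2 b2).
have b'g: b' \in g by rewrite -(h a b').
apply: (@sfree_spider _ _ e v b2 b1 a1 b a b') => //.
- exact: (vall a2 b2).
- exact: (vall a1 b1).
all: by apply: sep => //; rewrite ?af ?bg ?b'g ?(negbTE a1f) ?(negbTE b1g) ?(negbTE b2g).
Qed.

Lemma path7_ex (A B : finType) (e : A -> B -> bool) (a0 : A) (b0 : B) :
  sfree e -> indec e -> avoids e path7 -> ~ avoids (transp e) path7.
Proof.
move=> sf ind av av'.
(* The bipartite complement of P6 is P4 + K2. *)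
suff : avoids e (map (map negb) path6).
  move=> /avoids_compl; apply: (@path6_ex _ _ (compl e) a0 b0);
    [exact: sfree_compl|exact: indec_compl].
move=> s t; apply/eqP.
case: s => [|a1 [|a2 [|a3 [|? ?]]]] //; case: t => [|b1 [|b2 [|b3 [|? ?]]]] //.
case=> e11 e12 e13 e21 e22 e23 e31 e32 e33.
(* Starting from P4 + K2 itself keeps the path [a2]-[b3]-[a1]-[b2] inside every larger pair, as
   [attached_path4] requires. *)
apply: (@splittable_absurd _ _ e [set a1; a2; a3] [set b1; b2; b3] sf ind).
- move=> X Y v f g b a b' c c' /subsetP sX /subsetP sY vX nsp H.
  apply: (@attached_path4 _ _ e X Y v f g b a b' c c' a2 a1 b3 b2) => //;
    by rewrite ?e12 ?e13 ?e23 ?e22 ?sX ?sY // !inE eqxx ?orbT.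
- move=> X Y v f g b a b' c c' /subsetP sX /subsetP sY vY nsp H.
  apply: (@attached_path4 _ _ (transp e) Y X v f g b a b' c c' b2 b3 a1 a2) => //;
    rewrite /transp ?e12 ?e13 ?e23 ?e22 ?sX ?sY // ?inE ?eqxx ?orbT //; exact: sfree_transp.
have a31: a1 != a3 by apply: contraPneq e11 => ->; rewrite e31.
have a32: a2 != a3 by apply: contraPneq e21 => ->; rewrite e31.
have b12: b2 != b1 by apply: contraPneq e31 => <-; rewrite e32.
have b13: b3 != b1 by apply: contraPneq e31 => <-; rewrite e33.
exists [set a3], [set b1]; split.
- move=> x y; rewrite !inE -!orbA.
  by move=> /or3P[] /eqP-> /or3P[] /eqP->;
    rewrite ?e11 ?e12 ?e13 ?e21 ?e22 ?e23 ?e31 ?e32 ?e33 ?eqxx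
      ?(negbTE a31) ?(negbTE a32) ?(negbTE b12) ?(negbTE b13).
- by exists a3, b1; rewrite !inE !eqxx !orbT.
by exists a1, b3; rewrite !inE !eqxx !orbT.
Qed.

(** * Exchanging vertices in the copies of a pattern *)

Definition bits n := words n [:: true; false].
Definition mixed (w : bitseq) := (true \in w) && (false \in w).
Definition zcons (c : bitseq) (M : seq bitseq) := [seq x.1 :: x.2 | x <- zip c M].

(** The second alternative is a copy of [F] through the row [w], searched for as in [containsb]. *)
Definition exch forb F (w : bitseq) :=
  bad forb (w :: F) ||
  has (fun rs => (w \in rs) && all (mem (transpm rs)) (transpm F)) (words (size F) (w :: F)).

(* The finite checks behind the exchange argument. Adding a mixed row w to F either
   creates a forbidden pattern or a copy of F through w; and a full row is adjacent
   to every mixed column. *)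
Definition exch_test forb (F : seq bitseq) :=
  [&& all rect forb, rect F, has mixed F,
      all (fun r => false \in r) F,
      all (fun w => mixed w ==> exch forb F w) (bits (size (transpm F)))
    & all (fun c => mixed c ==>
          bad forb ((false :: nseq (size (transpm F)) true) :: zcons c F)) (bits (size F))].

(* Among three columns meeting a common row two are equal, and a new row cannot
   distinguish two equal columns. *)
Definition claw_test forb (F : seq bitseq) :=
  let cs := [seq c <- bits (size F) | mixed c && ~~ bad forb (zcons c F)] in
  all (fun c1 => all (fun c2 => all (fun c3 =>
    has (fun x => [&& x.1, x.2.1 & x.2.2]) (zip c1 (zip c2 c3)) ==>
      [|| c1 == c2, c1 == c3 | c2 == c3]) cs) cs) cs &&
  all (fun c => all (fun w => (false \in w) ==>
    bad forb ((true :: false :: w) :: zcons c (zcons c F))) (bits (size (transpm F)))) cs.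

Definition path8 : seq bitseq :=
  [:: [:: true; false; false; false]; [:: true; true; false; false];
      [:: false; true; true; false]; [:: false; false; true; true]].
Definition cycle8 : seq bitseq :=
  [:: [:: true; false; false; true]; [:: true; true; false; false];
      [:: false; true; true; false]; [:: false; false; true; true]].

Definition forb_skew := [:: skew; transpm skew].
(** C8 is its own bipartite complement, so one entry covers it; the complement of P8 has nine edges
    and is a different pattern. *)
Definition forb_all := [:: skew; transpm skew; path8; map (map negb) path8; cycle8].

Lemma exch_path8 : exch_test forb_skew path8 && exch_test forb_skew (transpm path8).
Proof. by vm_compute. Qed.
Lemma exch_cycle8 : exch_test forb_skew cycle8 && exch_test forb_skew (transpm cycle8).
Proof. by vm_compute. Qed.
Lemma exch_path7 : exch_test forb_all path7 && exch_test forb_all (transpm path7).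
Proof. by vm_compute. Qed.
Lemma claw_path8 : claw_test forb_skew path8. Proof. by vm_compute. Qed.
Lemma claw_cycle8 : claw_test forb_skew cycle8. Proof. by vm_compute. Qed.
Lemma claw_path7 : claw_test forb_all path7. Proof. by vm_compute. Qed.

Lemma mem_bits n (w : bitseq) : size w = n -> w \in bits n.
Proof.
elim: n w => [|n IH] [|x w] //= [/IH wn].
by apply/allpairsP; exists (x, w); split=> //; case: x.
Qed.

Lemma mixed_map (T : eqType) (f : pred T) s :
  mixed (map f s) -> exists y y', [/\ y \in s, y' \in s, f y & ~~ f y'].
Proof.
case/andP => /mapP[y ys fy] /mapP[y' y's fy'].
by exists y, y'; rewrite -fy -fy'.
Qed.

Lemma mixed_mapPn (T : eqType) (f : pred T) s :
  ~~ mixed (map f s) -> has f s -> all f s.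
Proof.
move=> nm /hasP[y ys fy]; apply/allP => x xs; apply: contraNT nm => /negbTE fx.
apply/andP; split; apply/mapP; first by exists y.
by exists x.
Qed.

Lemma mat_cons (A B : Type) (e : A -> B -> bool) s t b :
  mat e s (b :: t) = zcons [seq e a b | a <- s] (mat e s t).
Proof. by elim: s => //= a s ->. Qed.

(** A step may leave the new vertex out; [exch_ex] supplies the steps that use it. *)
Inductive exchanged (A B : eqType) (e : A -> B -> bool) (F : seq bitseq) s0 t0 :
    seq A -> seq B -> Prop :=
| exch_refl : exchanged e F s0 t0 s0 t0
| exch_row s t v s' t' : exchanged e F s0 t0 s t -> mixed [seq e v b | b <- t] ->
    {subset s' <= v :: s} -> {subset t' <= t} -> mat e s' t' = F ->
    exchanged e F s0 t0 s' t'
| exch_col s t u s' t' : exchanged e F s0 t0 s t -> mixed [seq e a u | a <- s] ->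
    {subset s' <= s} -> {subset t' <= u :: t} -> mat e s' t' = F ->
    exchanged e F s0 t0 s' t'.

Lemma rect_size_mat (A B : Type) (e : A -> B -> bool) s t F :
  rect F -> mat e s t = F -> size s = size F /\ size t = size (transpm F).
Proof.
by case/and3P => F0 _ _ E; rewrite -E in F0 *; rewrite size_map in F0;
  rewrite -mat_transp // !size_map.
Qed.

Lemma rect_mat_transp (A B : Type) (e : A -> B -> bool) s t F :
  rect F -> mat e s t = F <-> mat (transp e) t s = transpm F.
Proof.
case/and3P => F0 C0 /eqP FF; split=> E.
  by rewrite mat_transp ?E // -(size_map (fun a => [seq e a b | b <- t])) -/(mat e s t) E.
rewrite -[LHS]/(mat (transp (transp e)) s t) mat_transp ?E //.
by rewrite -(size_map (fun b => [seq transp e b a | a <- s])) -/(mat (transp e) t s) E.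
Qed.

Lemma exchanged_transp (A B : eqType) (e : A -> B -> bool) F s0 t0 s t :
  rect F -> exchanged e F s0 t0 s t -> exchanged (transp e) (transpm F) t0 s0 t s.
Proof.
move=> rF; elim=> [|s1 t1 v s' t' _ IH mx ss tt E|s1 t1 u s' t' _ IH mx ss tt E].
- exact: exch_refl.
- by apply: (exch_col IH mx) => //; apply/(rect_mat_transp _ _ _ rF).
by apply: (exch_row IH mx) => //; apply/(rect_mat_transp _ _ _ rF).
Qed.

Section Exchange.
Variables (A B : eqType) (e : A -> B -> bool).
Variables (forb : seq (seq bitseq)) (F : seq bitseq).
Hypotheses (hF : exch_test forb F) (av : avoids_all e forb).

Let rF : rect F. Proof. by case/and5P: hF. Qed.
Let rf : all rect forb. Proof. by case/andP: hF. Qed.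

Lemma exch_ex s t v :
  mat e s t = F -> mixed [seq e v b | b <- t] ->
  exists s' t', [/\ mat e s' t' = F, {subset s' <= v :: s}, {subset t' <= t} & v \in s'].
Proof.
move=> E mx; have [_ tF] := rect_size_mat rF E.
case/and5P: hF => _ _ _ _ /andP[/allP H _].
have wb : [seq e v b | b <- t] \in bits (size (transpm F)).
  by apply: mem_bits; rewrite size_map.
have := implyP (H _ wb) mx; rewrite /exch.
have -> : [seq e v b | b <- t] :: F = mat e (v :: s) t by rewrite /= E.
rewrite (not_bad _ _ rf av) /= => /hasP[rs rsM /andP[wrs /allP /= cols]].
have [s1 s1s E1] :=
  @sub_map_inv _ _ (fun x => [seq e x b | b <- t]) (v :: s) _ (mem_words rsM).
(* The row found has the trace of [v] but may be another vertex; it is replaced by [v] itself. *)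
pose s' := [seq if [seq e x b | b <- t] == [seq e v b | b <- t] then v else x | x <- s1].
have Es' : mat e s' t = rs.
  rewrite -E1 /mat -map_comp; apply: eq_map => x /=.
  by case: eqP => [->|].
have ss' : size s' = size F.
  by rewrite -(size_words rsM) -Es'; apply/esym/size_map.
have subs : {subset transpm F <= transpm (mat e s' t)} by move=> c /cols; rewrite Es'.
have [t' t't E'] := mat_cols rF ss' subs.
exists s', t'; split=> //.
  by move=> _ /mapP[x /s1s xs ->]; case: eqP => // _; rewrite mem_head.
move: wrs; rewrite -E1 => /mapP[x xs1 Ex]; apply/mapP; exists x => //.
by rewrite Ex eqxx.
Qed.

Lemma full_row_adj s t v u :
  mat e s t = F -> all (e v) t -> mixed [seq e a u | a <- s] -> e v u.
Proof.
move=> E /allP vt mx; have [sF tF] := rect_size_mat rF E.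
apply/negPn/negP => vu.
case/and5P: hF => _ _ _ _ /andP[_ /allP H].
have cb : [seq e a u | a <- s] \in bits (size F).
  by apply: mem_bits; rewrite size_map.
have := implyP (H _ cb) mx.
suff -> : (false :: nseq (size (transpm F)) true) :: zcons [seq e a u | a <- s] F
    = mat e (v :: s) (u :: t) by rewrite not_bad.
rewrite [in RHS]mat_cons /= (negbTE vu) E /zcons /=; congr ((_ :: _) :: _).
rewrite -tF; elim: (t) vt => //= b l IH vt.
by rewrite vt ?mem_head // -IH // => x xl; rewrite vt // inE xl orbT.
Qed.

(** A row step only selects among the columns, and a column step adds a column mixed on the copy,
    which a full row sees. *)
Lemma full_row_exchanged s0 t0 s t v :
  mat e s0 t0 = F -> all (e v) t0 -> exchanged e F s0 t0 s t ->
  mat e s t = F /\ all (e v) t.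
Proof.
move=> E0 v0; elim=> // s1 t1 u s' t' _ [E vt] mx ss tt E'; split=> //;
  apply/allP => y /tt; first exact: (allP vt).
rewrite inE => /predU1P[->|]; last exact: (allP vt).
exact: (full_row_adj E vt).
Qed.

Lemma empty_row_exchanged s0 t0 s t v :
  mat e s0 t0 = F -> ~~ has (e v) t0 ->
  (forall s t, exchanged e F s0 t0 s t -> ~~ mixed [seq e v b | b <- t]) ->
  exchanged e F s0 t0 s t -> ~~ has (e v) t.
Proof.
move=> E0 v0 nm; elim=> // s1 t1 u s' t' R vt mx ss tt E'.
  by apply: contra vt => /hasP[y /tt yt vy]; apply/hasP; exists y.
apply/negP => vt'.
have /allP at' : all (e v) t'.
  by apply: mixed_mapPn vt'; apply: (nm s'); apply: exch_col R mx ss tt E'.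
case/and5P: hF => _ _ /hasP[r rF' mr] _ _.
move: rF' mr; rewrite -E' => /mapP[a _ ->] /mixed_map[y [y' [yt y't ay ay']]].
(* [v] sees all of the new columns and none of the old ones, so only [u] is left; but a mixed row of
   [F] needs two columns. *)
have eu z : z \in t' -> z = u.
  move=> zt; have := tt _ zt; rewrite inE => /predU1P[//|zt1].
  by case/hasP: vt; exists z => //; apply: at'.
by rewrite (eu y) // -(eu y') // (negbTE ay') in ay.
Qed.
End Exchange.

(** Turns reachability by exchanges, a mere proposition, into a finite set; [classically] is enough
    because the final goals are Boolean. *)
Lemma classic_set (T : finType) (P : T -> Prop) :
  classically (exists X : {set T}, forall v, v \in X <-> P v).
Proof.
suff H (s : seq T) : classically (exists X : {set T}, forall v, v \in s -> (v \in X <-> P v)).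
  apply: classic_bind (H (enum T)) => -[X HX]; apply: classicW.
  by exists X => v; apply: HX; rewrite mem_enum.
elim: s => [|x s IH]; first by apply: classicW; exists set0.
apply: classic_bind IH => -[X HX]; apply: classic_bind (@classic_EM (P x)) => -[Px|nPx].
  apply: classicW; exists (x |: X) => v; rewrite in_setU1 inE.
  have [->|_] /= := eqVneq v x; first by [].
  exact: HX.
apply: classicW; exists (X :\ x) => v; rewrite in_setD1 inE.
have [->|_] /= := eqVneq v x; first by [].
exact: HX.
Qed.

(** A row mixed on a reachable copy is itself reachable. An outside row is thus full or empty on the
    first copy, and stays so on all of them. *)
Lemma row_module_exchanged (A B : finType) (e : A -> B -> bool) forb F s0 t0 (X :
  {set A}) (Y : {set B}) :
  exch_test forb F -> avoids_all e forb -> mat e s0 t0 = F ->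
  (forall v, v \in X <-> exists s t, exchanged e F s0 t0 s t /\ v \in s) ->
  (forall u, u \in Y <-> exists s t, exchanged e F s0 t0 s t /\ u \in t) ->
  row_module e X Y.
Proof.
move=> hF av E0 HX HY; split.
  move=> v b b' vX bY b'Y.
  have cp s t : exchanged e F s0 t0 s t -> mat e s t = F by case.
  have nm s t : exchanged e F s0 t0 s t -> ~~ mixed [seq e v b | b <- t].
    move=> R; apply: contra vX => mx; apply/HX.
    have [s' [t' [E' ss tt vs']]] := exch_ex hF av (cp _ _ R) mx.
    by exists s', t'; split=> //; apply: exch_row R mx ss tt E'.
  have [s [t [R bt]]] := (HY b).1 bY.
  have [s' [t' [R' b't']]] := (HY b').1 b'Y.
  have [vt0|vt0] := boolP (has (e v) t0).
    have vt0' : all (e v) t0 by apply: mixed_mapPn vt0; apply: nm; apply: exch_refl.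
    have [_ /allP h] := full_row_exchanged hF av E0 vt0' R.
    have [_ /allP h'] := full_row_exchanged hF av E0 vt0' R'.
    by rewrite h ?h'.
  have /hasPn h := empty_row_exchanged hF E0 vt0 nm R.
  have /hasPn h' := empty_row_exchanged hF E0 vt0 nm R'.
  by rewrite (negbTE (h _ bt)) (negbTE (h' _ b't')).
case/and5P: hF => _ _ /hasP[r rF' mr] _ _.
move: rF' mr; rewrite -E0 => /mapP[a as0 ->] /mixed_map[y [y' [yt y't ay ay']]].
exists a, y, y'; split=> //; [apply/HX|apply/HY|apply/HY];
  by exists s0, t0; split=> //; apply: exch_refl.
Qed.

Section Machine.
Variables (A B : finType) (e : A -> B -> bool).
Variables (forb : seq (seq bitseq)) (F : seq bitseq).
Hypotheses (sf : sfree e) (ind : indec e).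
Hypotheses (hF : exch_test forb F) (hF' : exch_test forb (transpm F)).
Hypotheses (av : avoids_all e forb) (av' : avoids_all (transp e) forb).

Let rF : rect F. Proof. by case/and5P: hF. Qed.
Let rF' : rect (transpm F). Proof. by case/and5P: hF'. Qed.
Let rf : all rect forb. Proof. by case/andP: hF. Qed.

Lemma exchanged_cover s0 t0 v : mat e s0 t0 = F ->
  classically (exists s t, exchanged e F s0 t0 s t /\ v \in s).
Proof.
move=> E0.
have exT s t : exchanged e F s0 t0 s t <-> exchanged (transp e) (transpm F) t0 s0 t s.
  split; first exact: exchanged_transp.
  by move/(exchanged_transp rF'); case/and3P: rF => _ _ /eqP->.
apply: classic_bind (@classic_set A (fun v => exists s t, exchanged e F s0 t0 s t /\ v \in s)).
move=> [X HX].
apply: classic_bind (@classic_set B (fun u => exists s t, exchanged e F s0 t0 s t /\ u \in t)).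
move=> [Y HY]; apply: classicW.
have m1 := row_module_exchanged hF av E0 HX HY.
have m2 : row_module (transp e) Y X.
  apply: (row_module_exchanged hF' av' ((rect_mat_transp _ _ _ rF).1 E0)) => u.
    apply: (iff_trans (HY u)); split=> [[s [t [R ut]]]|[t [s [R ut]]]].
      by exists t, s; split=> //; apply/exT.
    by exists s, t; split=> //; apply/exT.
  apply: (iff_trans (HX u)); split=> [[s [t [R ut]]]|[t [s [R ut]]]].
    by exists t, s; split=> //; apply/exT.
  by exists s, t; split=> //; apply/exT.
by have [EX _] := mixed_module_full sf ind (conj m1 m2); apply/HX; rewrite EX.
Qed.

(** A full row stays full under exchanges, yet lies in some reachable copy, where every row has a
    [false]. *)
Lemma no_full_row s t v : mat e s t = F -> ~~ all (e v) t.
Proof.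
move=> E; apply/negP => vt; suff: false by [].
apply: (@exchanged_cover _ _ v E) => -[s' [t' [R vs']]].
have [E' vt'] := full_row_exchanged hF av E vt R.
case/and5P: hF => _ _ _ /allP /(_ [seq e v b | b <- t']) H _.
move: H; rewrite -E' => /(_ (map_f _ vs')) /mapP[b bt'].
by rewrite (allP vt' _ bt').
Qed.
End Machine.

Lemma has_zip3 (T : Type) (f g h : T -> bool) s :
  has (fun x => [&& x.1, x.2.1 & x.2.2]) (zip (map f s) (zip (map g s) (map h s)))
    = has (fun x => [&& f x, g x & h x]) s.
Proof. by elim: s => //= x s ->. Qed.

Definition twins (A B : finType) (e : A -> B -> bool) b b' :=
  [forall x, e x b == e x b'].

(** Exchanges lead to a copy with [a] among its rows. There the traces of the three columns share a
    [true], so two of them are equal by the test, and columns with equal traces are twins. *)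
Lemma no_claw (A B : finType) (e : A -> B -> bool) forb F s0 t0 a b1 b2 b3 :
  sfree e -> indec e -> exch_test forb F -> exch_test forb (transpm F) ->
  claw_test forb F -> avoids_all e forb -> avoids_all (transp e) forb ->
  mat e s0 t0 = F -> e a b1 -> e a b2 -> e a b3 ->
  [|| twins e b1 b2, twins e b1 b3 | twins e b2 b3].
Proof.
move=> sf ind hF hF' /andP[/allP cl /allP tw] av av' E0 ab1 ab2 ab3.
have rF : rect F by case/and5P: hF.
have rf : all rect forb by case/andP: hF.
apply: (exchanged_cover sf ind hF hF' av av' (v := a) E0) => -[s [t [R as_]]].
have E : mat e s t = F by case: R.
have [sF tF] := rect_size_mat rF E.
have nfr v : ~~ all (e v) t := no_full_row sf ind hF hF' av av' v E.
have nfc u : ~~ all (transp e u) s.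
  have E' := (rect_mat_transp e s t rF).1 E.
  apply: (no_full_row (sfree_transp sf) (indec_transp ind) hF' _ av' av u E').
  by case/and3P: rF => _ _ /eqP->.
pose col u := [seq e x u | x <- s].
pose cs := [seq c <- bits (size F) | mixed c && ~~ bad forb (zcons c F)].
have colP u : e a u -> col u \in cs.
  move=> au; rewrite mem_filter mem_bits ?size_map // andbT; apply/andP; split.
    apply: contraNT (nfc u) => nm; apply: (@mixed_mapPn _ (transp e u) s nm).
    by apply/hasP; exists a.
  by rewrite -E -mat_cons not_bad.
have twP u u' : e a u -> col u = col u' -> twins e u u'.
  suff tw1 w w' x : e a w -> col w = col w' -> e x w -> e x w'.
    move=> au cu; have au' : e a u'.
      by move: cu => /eq_in_map /(_ a as_) <-.
    by apply/forallP => x; apply/eqP; apply/idP/idP; apply: tw1.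
  move=> aw cw xw; apply/negPn/negP => xw'.
  have xb : [seq e x b | b <- t] \in bits (size (transpm F)).
    by apply: mem_bits; rewrite size_map.
  have := allP (tw _ (colP w aw)) _ xb.
  have -> /= : false \in [seq e x b | b <- t].
    have /allPn[b bt xb'] := nfr x.
    by apply/mapP; exists b => //; apply/esym/negbTE.
  suff -> : (true :: false :: [seq e x b | b <- t]) :: zcons (col w) (zcons (col w) F)
      = mat e (x :: s) (w :: w' :: t) by rewrite not_bad.
  by rewrite /= xw (negbTE xw') {2}cw -E -!mat_cons.
have := allP (allP (cl _ (colP _ ab1)) _ (colP _ ab2)) _ (colP _ ab3).
rewrite has_zip3; have -> /= : has (fun x => [&& e x b1, e x b2 & e x b3]) s.
  by apply/hasP; exists a; rewrite ?ab1 ?ab2.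
case/or3P => /eqP c; apply/or3P; [constructor 1|constructor 2|constructor 3];
  exact: twP c.
Qed.

(** * Claw-free relations and the reduction *)

Definition claw_free (A B : finType) (e : A -> B -> bool) :=
  forall a b1 b2 b3, e a b1 -> e a b2 -> e a b3 ->
    [|| twins e b1 b2, twins e b1 b3 | twins e b2 b3].

(** P8 or C8 in [e], or P8 in its complement, gives claw-freeness through [forb_skew]. Without them
    all of [forb_all] is avoided, and the P7 in [e] or in its transpose serves as the pattern. *)
Lemma claw_free_cases (A B : finType) (e : A -> B -> bool) (a0 : A) (b0 : B) :
  sfree e -> indec e ->
  ~ claw_free e -> ~ claw_free (compl e) -> ~ claw_free (transp e) -> False.
Proof.
move=> sf ind nc nc' nct.
have avs (A' B' : finType) (e' : A' -> B' -> bool) : sfree e' -> avoids_all e' forb_skew.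
  move=> [s1 s2] N; rewrite !inE => /orP[] /eqP-> //.
  exact: (@avoids_transp _ _ (transp e') skew).
have av8 (e' : A -> B -> bool) F : sfree e' -> indec e' -> ~ claw_free e' ->
    exch_test forb_skew F && exch_test forb_skew (transpm F) -> claw_test forb_skew F ->
      avoids e' F.
  move=> sf' ind' nc1 /andP[t1 t2] ct s t; apply/eqP => E; case: nc1 => a b1 b2 b3.
  exact: (no_claw sf' ind' t1 t2 ct (avs _ _ _ sf') (avs _ _ _ (sfree_transp sf')) E).
have p8 := av8 _ _ sf ind nc exch_path8 claw_path8.
have c8 := av8 _ _ sf ind nc exch_cycle8 claw_cycle8.
have /avoids_compl q8 := av8 _ _ (sfree_compl sf) (indec_compl ind) nc' exch_path8 claw_path8.
have {}q8 : avoids e (map (map negb) path8).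
  move=> s t; have := q8 s t; rewrite !mat_compl; apply: contra => /eqP->.
  by apply/eqP; rewrite -!map_comp.
have av : avoids_all e forb_all.
  move=> N; rewrite !inE => /or4P[/eqP->|/eqP->|/eqP->|/orP[] /eqP->] //.
    by case: sf.
  by apply: (@avoids_transp _ _ (transp e) skew) => //; case: sf.
have avt : avoids_all (transp e) forb_all.
  have T F : rect F -> rect (transpm F) -> containsb F (transpm F) -> avoids e F ->
    avoids (transp e) F.
    by move=> r1 r2 c /(avoids_transp r1); apply: avoids_sub.
  move=> N; rewrite !inE => /or4P[/eqP->|/eqP->|/eqP->|/orP[] /eqP->].
  - by case: sf.
  - by apply: (@avoids_transp _ _ e skew) => //; case: sf.
  - exact: T p8.
  - exact: T q8.
  - exact: T c8.
have /andP[t1 t2] := exch_path7.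
apply: (path7_ex a0 b0 sf ind) => s t; apply/eqP => E.
  by apply: nc => a b1 b2 b3; apply: (no_claw sf ind t1 t2 claw_path7 av avt E).
apply: nct => a b1 b2 b3.
exact: (no_claw (sfree_transp sf) (indec_transp ind) t1 t2 claw_path7 avt av E).
Qed.

(** * Counting with twin classes *)

Definition homfree (A B : finType) (e : A -> B -> bool) s n :=
  forall (X : {set A}) (Y : {set B}), n <= #|X| -> n <= #|Y| ->
    ~ {in X & Y, forall a b, e a b = s}.

Lemma homfree_transp (A B : finType) (e : A -> B -> bool) s n :
  homfree e s n -> homfree (transp e) s n.
Proof. by move=> h X Y nX nY H; apply: (h Y X nY nX) => a b aY bX; apply: H. Qed.

Lemma homfree_compl (A B : finType) (e : A -> B -> bool) s n :
  homfree e s n -> homfree (compl e) (~~ s) n.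
Proof.
move=> h X Y nX nY H; apply: (h X Y nX nY) => a b aX bY.
by apply: negb_inj; apply: H.
Qed.

Lemma twins_trans (A B : finType) (e : A -> B -> bool) b1 b2 b3 :
  twins e b1 b2 -> twins e b2 b3 -> twins e b1 b3.
Proof.
by move=> /forallP h1 /forallP h2; apply/forallP => x; rewrite (eqP (h1 x)).
Qed.

Lemma twins_sym (A B : finType) (e : A -> B -> bool) b1 b2 :
  twins e b1 b2 = twins e b2 b1.
Proof. by apply: eq_forallb => x; rewrite eq_sym. Qed.

Definition twin_closed (A B : finType) (e : A -> B -> bool) (U : {set B}) :=
  [forall b in U, forall b', twins e b b' ==> (b' \in U)].

Lemma twin_closedP (A B : finType) (e : A -> B -> bool) (U : {set B}) :
  reflect (forall b b', b \in U -> twins e b b' -> b' \in U) (twin_closed e U).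
Proof.
apply: (iffP forall_inP) => [h b b' bU|h b bU].
  by have /forallP/(_ b')/implyP := h b bU.
by apply/forallP => b'; apply/implyP; apply: h.
Qed.

Lemma twin_closedC (A B : finType) (e : A -> B -> bool) (U : {set B}) :
  twin_closed e U -> twin_closed e (~: U).
Proof.
move/twin_closedP => h; apply/twin_closedP => b b'; rewrite !inE => bU bb'.
by apply: contra bU => /h; apply; rewrite twins_sym.
Qed.

Lemma twin_closedI (A B : finType) (e : A -> B -> bool) (U V : {set B}) :
  twin_closed e U -> twin_closed e V -> twin_closed e (U :&: V).
Proof.
move=> /twin_closedP h /twin_closedP k; apply/twin_closedP => b b'.
rewrite !in_setI => /andP[bU bV] bb'.
by apply/andP; split; [exact: (h b)|exact: (k b)].
Qed.

(** In a twin-closed subset minimal with at least [q] elements, removing one class, of size at most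
    [m], must leave fewer than [q]. *)
Lemma pick_twin_closed (A B : finType) (e : A -> B -> bool) (W : {set B}) q m :
  (forall b, #|[set b' | twins e b b']| <= m) -> 0 < q ->
  twin_closed e W -> q <= #|W| ->
  exists U : {set B}, [/\ U \subset W, twin_closed e U, q <= #|U| & #|U| < q + m].
Proof.
move=> cm q0 cW qW.
pose P (U : {set B}) := [&& U \subset W, twin_closed e U & q <= #|U|].
have PW : P W by rewrite /P subxx cW.
case: (arg_minnP (fun U : {set B} => #|U|) PW) => U /and3P[UW cU qU] mn.
exists U; split=> //; rewrite ltnNge; apply/negP => big.
have [b bU] : exists b, b \in U by apply/card_gt0P; lia.
pose C := [set b' | twins e b b'].
have cC : twin_closed e C.
  apply/twin_closedP => x y; rewrite !inE; exact: twins_trans.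
have bC : b \in C by rewrite inE; apply/forallP => x.
have := cm b; rewrite -/C => Cm.
have := cardsID C U; rewrite addnC => cs.
have CI : #|U :&: C| <= #|C| by apply/subset_leq_card/subsetIr.
have C0 : 0 < #|U :&: C| by apply/card_gt0P; exists b; rewrite inE bU.
have := mn (U :\: C); rewrite /P setDE (subset_trans (subsetIl _ _) UW).
rewrite twin_closedI ?twin_closedC // -setDE /=; lia.
Qed.

Lemma claw_free_homfree (A B : finType) (e : A -> B -> bool) p q :
  0 < p -> 0 < q -> claw_free e -> homfree e true p -> homfree e false q ->
  5 * (p + q) <= #|A| -> 5 * (p + q) <= #|B| -> False.
Proof.
move=> p0 q0 cf hp hq cA cB.
(* The rows adjacent to a class number fewer than [p] and the others fewer than [q], if the class is
   larger than [p + q]. *)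
have cm b : #|[set b' | twins e b b']| <= p + q.
  rewrite leqNgt; apply/negP => big.
  have h1 : #|[set a | e a b]| < p.
    rewrite ltnNge; apply/negP => ge; apply: (hp _ [set b' | twins e b b'] ge); first lia.
    by move=> x y; rewrite !inE => xb /forallP/(_ x)/eqP <-.
  have h0 : #|~: [set a | e a b]| < q.
    rewrite ltnNge; apply/negP => ge; apply: (hq _ [set b' | twins e b b'] ge); first lia.
    by move=> x y; rewrite !inE => xb /forallP/(_ x)/eqP <-; apply/negbTE.
  have := cardsC [set a | e a b]; lia.
have cT : twin_closed e setT by apply/twin_closedP => b b'; rewrite !inE.
have [|U1 [_ c1 q1 s1]] := pick_twin_closed cm q0 cT; first by rewrite cardsT; lia.
have k1 := cardsC U1.
have [|U2 [/subsetP d2 c2 q2 s2]] := pick_twin_closed cm q0 (twin_closedC c1); first by lia.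
(* Each of [U1] and [U2] has fewer than [p + 2q] elements, so more than [3p + q] columns remain. *)
pose U3 := ~: U1 :&: ~: U2.
have c3 : twin_closed e U3 by apply: twin_closedI; apply: twin_closedC.
have q3 : q <= #|U3|.
  have := cardsC (U1 :|: U2); rewrite setCU -/U3.
  have := cardsU U1 U2; lia.
pose miss (U : {set B}) := [set a | [forall (b | b \in U), ~~ e a b]].
have missP (U : {set B}) : q <= #|U| -> #|miss U| < q.
  move=> qU; rewrite ltnNge; apply/negP => ge; apply: (hq (miss U) U ge qU) => x y.
  by rewrite inE => /forall_inP h /h/negbTE.
(* A row meeting all three sets would have three pairwise non-twin neighbours. The cover bounds the
   number of rows by [3q]. *)
have cover : [set: A] \subset miss U1 :|: miss U2 :|: miss U3.
  apply/subsetP => a _; rewrite !in_setU; apply/negPn/negP.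
  rewrite !negb_or !inE -andbA => /and3P[].
  move=> /forall_inPn[b1 b1U /negPn e1] /forall_inPn[b2 b2U /negPn e2].
  move=> /forall_inPn[b3 b3U /negPn e3].
  have /twin_closedP h1 := c1; have /twin_closedP h2 := c2.
  have := cf a b1 b2 b3 e1 e2 e3.
  move: (b3U); rewrite !inE => /andP[b31 b32].
  case/or3P => tw.
  - by have := d2 _ b2U; rewrite inE (h1 _ _ b1U tw).
  - by rewrite (h1 _ _ b1U tw) in b31.
  by rewrite (h2 _ _ b2U tw) in b32.
have := subset_leq_card cover; rewrite cardsT.
have := missP _ q1; have := missP _ q2; have := missP _ q3.
have := cardsU (miss U1 :|: miss U2) (miss U3); have := cardsU (miss U1) (miss U2).
lia.
Qed.

Lemma indec_homfree (A B : finType) (e : A -> B -> bool) p q :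
  0 < p -> 0 < q -> sfree e -> indec e -> homfree e true p -> homfree e false q ->
  5 * (p + q) <= #|A| -> 5 * (p + q) <= #|B| -> False.
Proof.
move=> p0 q0 sf ind hp hq cA cB.
have /card_gt0P[a0 _] : 0 < #|A| by lia.
have /card_gt0P[b0 _] : 0 < #|B| by lia.
apply: (claw_free_cases a0 b0 sf ind) => cf.
- exact: (claw_free_homfree p0 q0 cf).
- by apply: (claw_free_homfree q0 p0 cf (homfree_compl hq) (homfree_compl hp)); rewrite addnC.
exact: (claw_free_homfree p0 q0 cf (homfree_transp hp) (homfree_transp hq)).
Qed.

(** * Reduction to indecomposable relations *)

Definition homogeneous (A B : finType) (e : A -> B -> bool) (X : {set A}) (Y : {set B}) :=
  (forall a b b', a \notin X -> b \in Y -> b' \in Y -> e a b = e a b') /\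
  (forall b a a', b \notin Y -> a \in X -> a' \in X -> e a b = e a' b).

(** Rows outside [X] are constant on the large set [Y]: fewer than [p] are full on it and fewer than
    [q] are empty. *)
Lemma homogeneous_card (A B : finType) (e : A -> B -> bool) p q (X : {set A}) (Y : {set B}) :
  homfree e true p -> homfree e false q -> 0 < p -> 0 < q -> p + q <= #|Y| ->
  (forall a b b', a \notin X -> b \in Y -> b' \in Y -> e a b = e a b') ->
  #|A| < #|X| + (p + q).
Proof.
move=> hp hq p0 q0 cY hX.
have /card_gt0P[b0 b0Y] : 0 < #|Y| by lia.
have h1 : #|~: X :&: [set a | e a b0]| < p.
  rewrite ltnNge; apply/negP => ge; apply: (hp _ Y ge); first lia.
  by move=> a b; rewrite !inE => /andP[aX ab] bY; rewrite (hX a b b0).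
have h0 : #|~: X :\: [set a | e a b0]| < q.
  rewrite ltnNge; apply/negP => ge; apply: (hq _ Y ge); first lia.
  by move=> a b; rewrite !inE => /andP[/negbTE ab aX] bY; rewrite (hX a b b0).
have := cardsC X; have := cardsID [set a | e a b0] (~: X); lia.
Qed.

Section Restrict.
Variables (A B : finType) (e : A -> B -> bool) (X : {set A}) (Y : {set B}).

Definition restr (a : {a | a \in X}) (b : {b | b \in Y}) := e (val a) (val b).

Lemma restr_avoids N : avoids e N -> avoids restr N.
Proof.
move=> av s t; have := av (map val s) (map val t); apply: contra => /eqP <-.
by apply/eqP; rewrite /mat -map_comp; apply: eq_map => a /=; rewrite -map_comp.
Qed.

Lemma restr_homfree s n : homfree e s n -> homfree restr s n.
Proof.
move=> h U V nU nV H; apply: (h (val @: U) (val @: V)).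
- by rewrite card_imset //; apply: val_inj.
- by rewrite card_imset //; apply: val_inj.
by move=> _ _ /imsetP[a aU ->] /imsetP[b bV ->]; apply: H.
Qed.
End Restrict.

Lemma restr_sfree (A B : finType) (e : A -> B -> bool) (X : {set A}) (Y : {set B}) :
  sfree e -> sfree (@restr A B e X Y).
Proof.
case=> s1 s2; split; first exact: restr_avoids.
exact: (@restr_avoids _ _ (transp e) Y X).
Qed.

Lemma homfree_const (A B : finType) (e : A -> B -> bool) p q (U : {set A}) (V : {set B}) s :
  homfree e true p -> homfree e false q -> {in U & V, forall a b, e a b = s} ->
  #|U| < p + q \/ #|V| < p + q.
Proof.
move=> hp hq H; have [lU|lU] := ltnP #|U| (p + q); first by left.
have [lV|lV] := ltnP #|V| (p + q); first by right.
case: s H => H; first by case: (hp U V) => //; lia.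
by case: (hq U V) => //; lia.
Qed.

Lemma sfree_homfree (A B : finType) (e : A -> B -> bool) p q :
  0 < p -> 0 < q -> sfree e -> homfree e true p -> homfree e false q ->
  6 * (p + q) <= #|A| -> 6 * (p + q) <= #|B| -> False.
Proof.
move=> p0 q0 sf hp hq cA cB.
suff G n (X : {set A}) (Y : {set B}) : #|X| + #|Y| < n -> homogeneous e X Y ->
    p + q <= #|X| -> p + q <= #|Y| -> False.
  apply: (G _ setT setT (leqnn _)); rewrite ?cardsT; try lia.
  by split=> ? ? ?; rewrite inE.
elim: n => // n IHn in X Y *; rewrite ltnS => lt_n [hX hY] cX cY.
have bX : 5 * (p + q) <= #|X| by have := homogeneous_card hp hq p0 q0 cY hX; lia.
have bY : 5 * (p + q) <= #|Y|.
  by have := homogeneous_card (homfree_transp hp) (homfree_transp hq) p0 q0 cX hY; lia.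
apply: (@indec_homfree _ _ (@restr A B e X Y) p q p0 q0).
- exact: restr_sfree.
- move=> U V s t UV VU.
  pose U1 := val @: U; pose V1 := val @: V.
  have U1X : U1 \subset X by apply/subsetP => _ /imsetP[a _ ->]; apply: valP.
  have V1Y : V1 \subset Y by apply/subsetP => _ /imsetP[b _ ->]; apply: valP.
  have UV1 : {in U1 & Y :\: V1, forall a b, e a b = s}.
    move=> _ b /imsetP[a aU ->]; rewrite inE => /andP[bV bY'].
    apply: (UV a (Sub b bY') aU); apply: contra bV => bV.
    by apply/imsetP; exists (Sub b bY').
  have VU1 : {in X :\: U1 & V1, forall a b, e a b = t}.
    move=> a b0; rewrite inE => /andP[aU aX] /imsetP[b bV ->].
    apply: (VU (Sub a aX) b _ bV); apply: contra aU => aU.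
    by apply/imsetP; exists (Sub a aX).
  have cU := cardsID U1 X; have cV := cardsID V1 Y.
  rewrite (setIidPr U1X) in cU; rewrite (setIidPr V1Y) in cV.
  have eU : #|U1| = #|U| by apply: card_imset; apply: val_inj.
  have eV : #|V1| = #|V| by apply: card_imset; apply: val_inj.
  have h1 := homfree_const hp hq UV1; have h2 := homfree_const hp hq VU1.
  (* The constant rectangles force [U1] and [V1] to be both small, or else their complements. The
     remaining pair is large and again homogeneous, so by induction it is all of ([X], [Y]). *)
  have [lU|lU] := ltnP #|U1| (p + q).
    left; suff : ~~ (0 < #|U1| + #|V1|).
      by rewrite eU eV => z; split; apply/eqP; rewrite -cards_eq0; lia.
    apply/negP => z; apply: (IHn (X :\: U1) (Y :\: V1)); try lia.
    split=> [a b b'|b a a'].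
      rewrite !inE negb_and negbK => /orP[aU|aX] /andP[bV bY'] /andP[bV' bY''].
        by rewrite !UV1 // inE ?bV ?bV'.
      exact: hX.
    rewrite !inE negb_and negbK => /orP[bV|bY'] /andP[aU aX] /andP[aU' aX'].
      by rewrite !VU1 // inE ?aU ?aU'.
    exact: hY.
  right; suff : ~~ (0 < #|X :\: U1| + #|Y :\: V1|).
    move=> z; have fU : #|U| = #|X| by lia.
    have fV : #|V| = #|Y| by lia.
    by split; apply/eqP; rewrite eqEcard subsetT cardsT card_sig ?fU ?fV /=.
  apply/negP => z; apply: (IHn U1 V1); try lia.
  split=> [a b b' aU bV bV'|b a a' bV aU aU'].
    have [aX|aX] := boolP (a \in X); first by rewrite !VU1 // inE aU.
    by apply: hX => //; apply: (subsetP V1Y).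
  have [bY'|bY'] := boolP (b \in Y); first by rewrite !UV1 // inE bV.
  by apply: hY => //; apply: (subsetP U1X).
- exact: restr_homfree.
- exact: restr_homfree.
- by rewrite card_sig.
by rewrite card_sig.
Qed.

(** * From relations back to graphs *)

Lemma embed (H G : sgraph) (h : H -> G) :
  injective h -> (forall x y, adj (h x) (h y) = adj x y) -> contains_induced H G.
Proof.
move=> ih ah; exists (h @: setT).
have hP x : h x \in h @: setT by apply: imset_f; rewrite inE.
exists (fun x => Sub (h x) (hP x) : induced (h @: setT)); split=> //.
have /fin_all_exists[g gP] (y : induced (h @: setT)) : exists x, h x = val y.
  by have /imsetP[x _ ->] := valP y; exists x.
exists g => [x|y]; first by apply: ih; rewrite gP.
by apply: val_inj; rewrite /= gP.
Qed.

Lemma contains_Knn (G : bigraph) n (X Y : {set G}) :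
  X \subset partA G -> Y \subset partB G -> n <= #|X| -> n <= #|Y| ->
  {in X & Y, forall a b, adj a b} -> contains_induced (Knn n) G.
Proof.
move=> /subsetP XA /subsetP YB nX nY XY.
pose h (x : Knn n) : G := match x with
  | inl i => enum_val (widen_ord nX i)
  | inr i => enum_val (widen_ord nY i) end.
have XYn x y : x \in X -> y \in Y -> x <> y.
  by move=> /XA xA /YB yB E; have := disjointFr (parts_disjoint G) xA; rewrite E yB.
apply: (@embed _ _ h).
- case=> i [] j //= E.
  + by congr inl; apply/val_inj; have /(congr1 val) := enum_val_inj E.
  + by case: (XYn _ _ (enum_valP (widen_ord nX i)) (enum_valP (widen_ord nY j)) E).
  + by case: (XYn _ _ (enum_valP (widen_ord nX j)) (enum_valP (widen_ord nY i)) (esym E)).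
  by congr inr; apply/val_inj; have /(congr1 val) := enum_val_inj E.
case=> i [] j; rewrite /h.
- by apply/negbTE/(@partA_indep G); apply: XA; apply: enum_valP.
- by apply: XY; apply: enum_valP.
- by rewrite adj_sym; apply: XY; apply: enum_valP.
by apply/negbTE/(@partB_indep G); apply: YB; apply: enum_valP.
Qed.

Lemma contains_S123 (G : sgraph) (X Y : {set G}) (s t : seq G) :
  independent X -> independent Y -> {subset s <= X} -> {subset t <= Y} ->
  mat adj s t = skew -> contains_induced S123 G.
Proof.
move=> iX iY sX tY.
case: s sX => [|c [|m' [|q [|? ?]]]] sX //; case: t tY => [|l [|m [|p [|r [|? ?]]]]] tY //.
case=> e1 e2 e3 e4 e5 e6 e7 e8 e9 e10 e11 e12.
have X0 x y : x \in [:: c; m'; q] -> y \in [:: c; m'; q] -> adj x y = false.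
  by move=> /sX xX /sX yX; apply/negbTE/iX.
have Y0 x y : x \in [:: l; m; p; r] -> y \in [:: l; m; p; r] -> adj x y = false.
  by move=> /tY xX /tY yX; apply/negbTE/iY.
(* The order follows the numbering of [S123_edges]: centre, then the legs [l], [m]-[m'] and
   [p]-[q]-[r]. *)
pose h (i : S123) : G := nth c [:: c; l; m; m'; p; q; r] (val i).
have ah x y : adj (h x) (h y) = adj x y.
  case: x => -[|[|[|[|[|[|[|//]]]]]]] ?; case: y => -[|[|[|[|[|[|[|//]]]]]]] ?;
  rewrite /h /=; first [by rewrite X0 ?inE ?eqxx ?orbT | by rewrite Y0 ?inE ?eqxx ?orbT
    | by rewrite ?e1 ?e2 ?e3 ?e4 ?e5 ?e6 ?e7 ?e8 ?e9 ?e10 ?e11 ?e12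
    | by rewrite adj_sym ?e1 ?e2 ?e3 ?e4 ?e5 ?e6 ?e7 ?e8 ?e9 ?e10 ?e11 ?e12].
(* No two vertices of S_{1,2,3} have the same neighbourhood, so a map preserving adjacency and
   non-adjacency is injective. *)
apply: (@embed _ _ h) => // x y E.
have tw z : S123_adj x z = S123_adj y z by rewrite -[LHS]ah -[RHS]ah E.
move: (tw (@Ordinal 7 0 isT)) (tw (@Ordinal 7 2 isT)) (tw (@Ordinal 7 3 isT))
  (tw (@Ordinal 7 5 isT)) (tw (@Ordinal 7 4 isT)) (tw (@Ordinal 7 6 isT)).
case: x {E tw} => -[|[|[|[|[|[|[|//]]]]]]] ?; case: y => -[|[|[|[|[|[|[|//]]]]]]] ?;
  by move=> // *; apply: val_inj.
Qed.

Definition cross (G : bigraph) : {a | a \in partA G} -> {b | b \in partB G} -> bool :=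
  @restr _ _ adj (partA G) (partB G).

Lemma cross_sfree (G : bigraph) : S123_free G -> sfree (@cross G).
Proof.
move=> fr; split=> s t; apply/eqP => E; apply: fr.
  apply: (@contains_S123 G (partA G) (partB G) (map val s) (map val t)).
  - exact: partA_indep.
  - exact: partB_indep.
  - by move=> _ /mapP[x _ ->]; apply: valP.
  - by move=> _ /mapP[x _ ->]; apply: valP.
  by rewrite -E /mat -map_comp; apply: eq_map => a /=; rewrite -map_comp.
apply: (@contains_S123 G (partB G) (partA G) (map val s) (map val t)).
- exact: partB_indep.
- exact: partA_indep.
- by move=> _ /mapP[x _ ->]; apply: valP.
- by move=> _ /mapP[x _ ->]; apply: valP.
rewrite -E /mat -map_comp; apply: eq_map => a /=; rewrite -map_comp.
by apply: eq_map => b /=; rewrite adj_sym.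
Qed.

Lemma S123_free_bramsey p q : 0 < p -> 0 < q ->
  bramsey_property S123_free p q (6 * (p + q)).
Proof.
move=> p0 q0 G fr cA cB.
case: (classic (contains_induced (Knn p) G)) => [|np]; first by left.
case: (classic (contains_induced (Knn q) (bcompl G))) => [|nq]; first by right.
case: (@sfree_homfree _ _ (@cross G) p q p0 q0 (cross_sfree fr)).
- move=> X Y nX nY XY; apply: np; apply: (@contains_Knn G p (val @: X) (val @: Y)).
  + by apply/subsetP => _ /imsetP[x _ ->]; apply: valP.
  + by apply/subsetP => _ /imsetP[x _ ->]; apply: valP.
  + by rewrite card_imset //; apply: val_inj.
  + by rewrite card_imset //; apply: val_inj.
  by move=> _ _ /imsetP[x xX ->] /imsetP[y yY ->]; apply: XY.
- move=> X Y nX nY XY; apply: nq; apply: (@contains_Knn (bcompl G) q (val @: X) (val @: Y)).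
  + by apply/subsetP => _ /imsetP[x _ ->]; apply: valP.
  + by apply/subsetP => _ /imsetP[x _ ->]; apply: valP.
  + by rewrite card_imset //; apply: val_inj.
  + by rewrite card_imset //; apply: val_inj.
  move=> _ _ /imsetP[x xX ->] /imsetP[y yY ->].
  by rewrite /adj /= /bcompl_adj (valP x) (valP y) /=; apply/negbT; apply: XY.
- by rewrite card_sig.
by rewrite card_sig.
Qed.

(** Excluded middle replaces a decision procedure, as [bramsey_property] quantifies over all
    bigraphs. *)
Lemma classic_least (P : nat -> Prop) n :
  P n -> exists2 k, P k & k <= n /\ forall m, P m -> k <= m.
Proof.
elim/ltn_ind: n => n IH Pn.
case: (classic (exists2 m, m < n & P m)) => [[m mn Pm]|no].
  have [k Pk [km kl]] := IH m mn Pm; exists k => //; split=> //.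
  exact: leq_trans km (ltnW mn).
exists n => //; split=> // m Pm; rewrite leqNgt; apply/negP => mn.
by apply: no; exists m.
Qed.

Theorem theorem12 (p q : nat) (hp : 0 < p) (hq : 0 < q) :
  exists n : nat, is_bramsey S123_free p q n /\ n <= 6 * (p + q).
Proof.
have [k Pk [kn kl]] := classic_least (S123_free_bramsey hp hq).
by exists k.
Qed.
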